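(* Let $P_0,P_1\in\mathcal{P}(\mathbb{R}^d)$ and let $\gamma\in\mathcal{P}(\mathbb{R}^d\times\mathbb{R}^d)$ be a coupling with first and second marginals $P_0$ and $P_1$. Suppose that $X_t=(1-t)X_0+t\,X_1$ with $(X_0,X_1)\sim\gamma$, and that for all $t\in[0,1]$ we have $\mathbb{E}\,\|X_t\|^2<\infty$ and $\mathbb{E}\,\|\Pi_t(X_t)\|^2<\infty$, and that $t\mapsto\Pi_t(x)$ is continuous at $t=1$ for all $x\in\mathbb{R}^d$. Then we have $$\nabla\cdot(\rho_t\,\Pi_t)=0$$ only if there exists a measurable map $T:\mathbb{R}^d\to\mathbb{R}^d$ satisfying $T_\sharp P_0=P_1$ such that $$(\mathrm{id}\times T)_\sharp P_0=\gamma,$$ where $\mathrm{id}:\mathbb{R}^d\to\mathbb{R}^d$ is the identity map and $(\mathrm{id}\times T)(x)=(x,T(x))$. Moreover, the condition is sufficient for $t\in[0,1)$ provided the Jacobian of the map $T$ is positive semi-definite at every $x\in\mathbb{R}^d$. In particular, this holds when $T$ is a continuously differentiable optimal transport map (for the squared Euclidean cost) from $P_0$ to $P_1$, provided the process $X_t=(1-t)X_0+t\,T(X_0)$ satisfies $\mathbb{E}\,\|X_t\|^2<\infty$ and $\mathbb{E}\,\|\Pi_t(X_t)\|^2<\infty$ for all $t\in[0,1]$ and $t\mapsto\Pi_t(x)$ is continuous at $t=1$ for all $x\in\mathbb{R}^d$.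
   Context: For a stochastic process $(X_t)_{t\in[0,1]}$ on $\mathbb{R}^d$, $\rho_t$ denotes the density (w.r.t. Lebesgue measure) of the marginal law of $X_t$; $v_t(x)=\mathbb{E}[\dot X_t\mid X_t=x]$ is the conditional velocity; $\mathcal{C}_t(x)=\mathbb{E}[\dot X_t\otimes\dot X_t\mid X_t=x]$; and $\Pi_t(x)=\mathcal{C}_t(x)-v_t(x)\otimes v_t(x)$ is the conditional covariance (Reynolds stress) tensor. For a matrix field $V$, $(\nabla\cdot V)_j=\sum_i\partial_i V_{ij}$. Standing regularity assumptions: the marginal densities $\rho_t$ exist for all $t\in[0,1]$; sample paths $t\mapsto X_t(\omega)$ lie in $W^{2,2}([0,1];\mathbb{R}^d)$; the flow map $\phi_t$ of $\partial_t\phi_t(x)=v_t(\phi_t(x))$, $\phi_0(x)=x$, has $t\mapsto\phi_t(x)$ in $C^2$ and $x\mapsto\phi_t(x)$ a homeomorphism for each $t$; and $(t,x)\mapsto v_t(x)$ is jointly continuously differentiable. *)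

(* Defs.v *)
From HB Require Import structures.
From mathcomp Require Import all_boot all_order all_algebra.
From mathcomp Require Import all_classical all_reals all_analysis.
Set Implicit Arguments. Unset Strict Implicit. Unset Printing Implicit Defensive.
Import Order.TTheory GRing.Theory Num.Theory.
Import numFieldNormedType.Exports.
Local Open Scope classical_set_scope.
Local Open Scope ring_scope.

Section BorelRd.
Context (R : realType) (m n : nat).

Lemma borelRd_C (A : set 'M[R]_(m, n)) :
  <<s (@open 'M[R]_(m, n)) >> A -> <<s (@open 'M[R]_(m, n)) >> (~` A).
Proof. by move=> sGA; rewrite -setTD; exact: sigma_algebraCD. Qed.

HB.instance Definition _ := @isMeasurable.Build (sigma_display (@open 'M[R]_(m, n)))
  'M[R]_(m, n) <<s (@open 'M[R]_(m, n)) >> (@sigma_algebra0 _ setT _) borelRd_C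
  (@sigma_algebra_bigcup _ setT _).
End BorelRd.

Section Defs.
Context (R : realType) (d : nat).
Local Notation V := 'rV[R]_d.
Local Notation M := 'M[R]_d.

Definition dotv (u v : V) : R := \sum_(i < d) u ord0 i * v ord0 i.
Definition sqnorm (u : V) : R := dotv u u.
Definition sqnormM (A : M) : R := \sum_(i < d) \sum_(j < d) A i j ^+ 2.

Definition ebasis (i : 'I_d) : V := delta_mx ord0 i.

(* Interpolant X_t = (1-t) X_0 + t X_1 and its velocity X_1 - X_0 on the
   canonical sample space R^d x R^d (with (X_0, X_1) = identity). *)
Definition Xt (t : R) (z : V * V) : V := (1 - t) *: z.1 + t *: z.2.
Definition Xdot (z : V * V) : V := z.2 - z.1.

Definition outer (u : V) : M := \matrix_(i, j) (u ord0 i * u ord0 j).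

(* ---- Lebesgue integral on R^d, as the iterated integral over the d
   coordinates with respect to the Lebesgue measure on R (Fubini/Tonelli). *)
Fixpoint iint (k : nat) (F : (nat -> R) -> \bar R) (y : nat -> R) : \bar R :=
  match k with
  | 0 => F y
  | k'.+1 => (\int[@lebesgue_measure R]_x iint k' F
                 (fun n => if n == k' then x else y n))%E
  end.

Definition lebint (f : V -> \bar R) : \bar R :=
  iint d (fun y => f (\row_(i < d) y i)) (fun _ => 0).

Definition is_density (gamma : probability (V * V)%type R) (t : R) (rho : V -> R) :=
  (forall x, 0 <= rho x) /\ measurable_fun setT rho /\
  forall A : set V, measurable A ->
    gamma (Xt t @^-1` A) = lebint (fun x => (rho x)%:E * (\1_A x)%:E)%E.

(* v_t = E[ Xdot | X_t = . ] (a version of the conditional expectation). *)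
Definition is_cond_velocity (gamma : probability (V * V)%type R) (t : R) (vt : V -> V) :=
  measurable_fun setT vt /\
  forall j : 'I_d,
    gamma.-integrable setT (fun z => (vt (Xt t z) ord0 j)%:E) /\
    forall A : set V, measurable A ->
      (\int[gamma]_z ((Xdot z ord0 j) * \1_A (Xt t z))%:E =
       \int[gamma]_z ((vt (Xt t z) ord0 j) * \1_A (Xt t z))%:E)%E.

Definition is_cond_second_moment (gamma : probability (V * V)%type R) (t : R) (Ct : V -> M) :=
  measurable_fun setT Ct /\
  forall i j : 'I_d,
    gamma.-integrable setT (fun z => (Ct (Xt t z) i j)%:E) /\
    forall A : set V, measurable A ->
      (\int[gamma]_z ((Xdot z ord0 i * Xdot z ord0 j) * \1_A (Xt t z))%:E =
       \int[gamma]_z ((Ct (Xt t z) i j) * \1_A (Xt t z))%:E)%E.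

Definition Pi (Ct : V -> M) (vt : V -> V) (x : V) : M := Ct x - outer (vt x).

Fixpoint iderive (s : seq V) (f : V -> V) : V -> V :=
  if s is v :: s' then (fun x => 'D_v (iderive s' f) x) else f.

Definition smooth (f : V -> V) : Prop :=
  forall s : seq V, continuous (iderive s f) /\
    forall (v x : V), derivable (iderive s f) x v.

Definition test_function (f : V -> V) : Prop :=
  smooth f /\ compact (closure [set x | f x != 0]).

Definition partial (i j : 'I_d) (phi : V -> V) (x : V) : R :=
  ('D_(ebasis i) phi x) ord0 j.

(* Weak (distributional) form of  div (rho Pi) = 0, where
   (div V)_j = sum_i partial_i V_ij :
   for every test field phi,  int rho(x) sum_{i,j} Pi_ij(x) partial_i phi_j(x) dx = 0. *)
Definition div_rhoPi_zero (rho : V -> R) (Pit : V -> M) : Prop :=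
  forall phi : V -> V, test_function phi ->
    lebint (fun x => (rho x * \sum_(i < d) \sum_(j < d)
                          Pit x i j * partial i j phi x)%:E) = 0%E.

Definition jointly_C1 (v : R -> V -> V) : Prop :=
  let F := fun p : R * V => v p.1 p.2 in
  (forall p, differentiable F p) /\
  forall w : R * V, continuous (fun p => 'D_w F p).

Definition C1map (T : V -> V) : Prop :=
  (forall x, differentiable T x) /\ forall w : V, continuous (fun x => 'D_w T x).

Definition C2curve (c : R -> V) : Prop :=
  (forall t, derivable c t 1) /\ (forall t, derivable (derive1 c) t 1) /\
  continuous (derive1n 2 c).

Definition homeomorphism (f : V -> V) : Prop :=
  continuous f /\ exists g : V -> V, continuous g /\ cancel f g /\ cancel g f.

Definition flow_assumption (v : R -> V -> V) : Prop :=
  exists phi : R -> V -> V,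
    (forall x, phi 0 x = x) /\
    (forall x, C2curve (phi ^~ x)) /\
    (forall x t, 0 <= t <= 1 -> derive1 (phi ^~ x) t = v t (phi t x)) /\
    (forall t, 0 <= t <= 1 -> homeomorphism (phi t)).

Definition jacobian_psd (T : V -> V) (x : V) : Prop :=
  differentiable T x /\ forall h : V, 0 <= dotv h ('d T x h).

Definition is_coupling (P0 P1 : probability V R) (pi : probability (V * V)%type R) :=
  (forall A : set V, measurable A -> pushforward pi fst A = P0 A) /\
  (forall A : set V, measurable A -> pushforward pi snd A = P1 A).

Definition is_OT_map (P0 P1 : probability V R) (T : V -> V) : Prop :=
  measurable_fun setT T /\
  (forall A : set V, measurable A -> pushforward P0 T A = P1 A) /\
  forall pi : probability (V * V)%type R, is_coupling P0 P1 pi ->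
    (\int[P0]_x (sqnorm (x - T x))%:E <= \int[pi]_z (sqnorm (z.1 - z.2))%:E)%E.

End Defs.

(* Main.v *)
Require Import Defs.
From HB Require Import structures.
From mathcomp Require Import all_boot all_order all_algebra.
From mathcomp Require Import all_classical all_reals all_analysis.
From mathcomp Require Import measurable_realfun ring lra.
Import Order.TTheory GRing.Theory Num.Theory.
Import numFieldNormedType.Exports.
Local Open Scope classical_set_scope.
Local Open Scope ring_scope.
Set Implicit Arguments. Unset Strict Implicit.

(** Necessity. Testing [div (rho_0 Pi_0) = 0] against truncations of the linear
    fields [x |-> x_j e_j] gives [E (Pi_0)_jj (X_0) = 0], that is
    [E |X_1 - X_0 - v_0 (X_0)|^2 = 0]; hence [X_1 = X_0 + v_0 (X_0)] almost surely.

    Sufficiency. If [T] is continuous and monotone on a closed set [K] of full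
    [P0]-measure, then for [t < 1] the map [(1 - t) id + t T] is injective on [K]
    and sends Borel subsets of [K] to Borel sets. So every event is, up to a null
    set, determined by [X_t]; the velocity [X_1 - X_0] is thus a function of
    [X_t] and [Pi_t (X_t) = 0] almost surely. A positive semi-definite Jacobian
    makes [T] monotone everywhere. If [T] is optimal, exchanging the images of
    independent [P0]-distributed [x] and [y] whenever
    [<T x - T y, x - y> < 0] is a competing coupling which would be strictly
    cheaper unless such pairs are negligible; so [T] is monotone on the support
    of [P0]. *)

(** * Borel sets of row vectors *)

Section BorelMatrix.
Context {R : realType}.

(** The hypotheses on the process are expectations under [gamma], whereas the divergence equation
    uses an integral iterated over coordinates. The two are compared as positive functionals that
    agree on indicators; signed integrands can be treated only after absolute integrability is
    known. In the necessity part the diagonal entries suffice, since each is the conditional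
    variance of one component of the velocity. Time 0 is chosen because the position is then [X_0]
    itself, so that a function of the position is a function of the starting point. In the
    sufficiency part, closedness of [K] is what makes images of Borel sets Borel: a closed set is a
    countable union of compact sets. Injectivity comes from the term [(1 - t) |x - y|^2], which
    degenerates at [t = 1]. Optimality yields monotonicity for almost every pair only; continuity of
    [T] upgrades this to every pair of points of the support, a closed set of full measure. *)

Lemma measurable_open_mx m n (A : set 'M[R]_(m, n)) : open A -> measurable A.
Proof. by move=> oA; exact: sub_sigma_algebra. Qed.

Lemma measurable_closed_mx m n (A : set 'M[R]_(m, n)) : closed A -> measurable A.
Proof.
by move=> cA; rewrite -(setCK A); apply: measurableC; apply: measurable_open_mx;
  exact: closed_openC.
Qed.

Lemma continuous_measurable_mx m n (f : 'M[R]_(m, n) -> R) :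
  continuous f -> measurable_fun setT f.
Proof.
move=> /continuousP cf; apply: (measurability _ (RGenOInfty.measurableE R)).
move=> _ [_ [x ->] <-]; rewrite setTI; apply: measurable_open_mx; apply: cf.
exact: interval_open.
Qed.

Lemma measurable_mx_coord m n (i : 'I_m) (j : 'I_n) :
  measurable_fun setT (fun A : 'M[R]_(m, n) => A i j).
Proof. by apply: continuous_measurable_mx => A; exact: coord_continuous. Qed.

(** Rational corners make the boxes a countable base of the topology. They serve for measurability
    of vector-valued maps and again for the support of a probability. *)
Definition rat_box d (p : 'rV[rat]_d * 'rV[rat]_d) : set 'rV[R]_d :=
  [set x | forall i, ratr (p.1 ord0 i) < x ord0 i < ratr (p.2 ord0 i)].

Lemma rat_box_basis d (U : set 'rV[R]_d) (x : 'rV[R]_d) :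
  nbhs x U -> exists p, rat_box p x /\ rat_box p `<=` U.
Proof.
move=> /nbhs_ballP [e /= e0 eU].
have lo i : {q : rat | ratr q \in `](x ord0 i - e), (x ord0 i)[}.
  by apply: cid; apply: rat_in_itvoo; rewrite ltrBlDr ltrDl.
have hi i : {q : rat | ratr q \in `](x ord0 i), (x ord0 i + e)[}.
  by apply: cid; apply: rat_in_itvoo; rewrite ltrDl.
exists (\row_i sval (lo i), \row_i sval (hi i)); split=> [i|y yp].
  rewrite /= !mxE; case: (lo i) => q /=; case: (hi i) => r /=.
  by rewrite !in_itv /= => /andP[-> _] /andP[_ ->].
apply: eU; split=> // i j; rewrite (ord1 i) /ball /= distrC ltr_distl.
move: (yp j); rewrite /= !mxE.
case: (lo j) => q /=; case: (hi j) => r /=.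
rewrite !in_itv /= => /andP[_ r2] /andP[q1 _] /andP[y1 y2].
by apply/andP; split; [exact: lt_trans y1|exact: lt_trans r2].
Qed.

Lemma rat_box_open d (p : 'rV[rat]_d * 'rV[rat]_d) : open (rat_box p).
Proof.
rewrite openE => x xp; apply: (@filter_forall _ _ (fun i (y : 'rV[R]_d) =>
  ratr (p.1 ord0 i) < y ord0 i < ratr (p.2 ord0 i)) (nbhs x)) => i.
have := @coord_continuous R 1 d ord0 i x.
have xn : nbhs (x ord0 i)
    `](ratr (p.1 ord0 i)), (ratr (p.2 ord0 i))[%classic.
  by apply: open_nbhs_nbhs; split; [exact: interval_open|rewrite /= in_itv /=; exact: xp].
move=> /(_ _ xn) h; apply: (@filterS _ (nbhs x) _ _ _ _ h) => y /=.
by rewrite in_itv.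
Qed.

Lemma open_rat_box d (U : set 'rV[R]_d) : open U ->
  U = \bigcup_(p in [set p | rat_box p `<=` U]) rat_box p.
Proof.
move=> oU; apply/seteqP; split=> [x Ux|x [p /= pU]]; last exact: pU.
have [p [px pU]] := rat_box_basis (open_nbhs_nbhs (conj oU Ux)).
by exists p.
Qed.

(** An open set is a countable union of rational boxes, and the preimage of a box is a finite
    intersection of preimages of intervals under the coordinates. *)
Lemma measurable_fun_rV disp (T : measurableType disp) d (f : T -> 'rV[R]_d) :
  (forall i, measurable_fun setT (fun t => f t ord0 i)) -> measurable_fun setT f.
Proof.
move=> mf; apply: (measurability (@open 'rV[R]_d) erefl) => // _ [U oU <-].
rewrite setTI (open_rat_box oU) bigcup_mkcond preimage_bigcup.
apply: countable_bigcupT_measurable => // p; case: ifPn => _; last first.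
  by rewrite preimage_set0.
rewrite (_ : _ @^-1` _ = \bigcap_(i : 'I_d) (setT `&`
    (fun t => f t ord0 i) @^-1` `](ratr (p.1 ord0 i)), (ratr (p.2 ord0 i))[)); last first.
  apply/seteqP; split=> t /= tp i; first by move=> _ /=; split=> //=;
    rewrite in_itv /=; exact: tp.
  by have [_ /=] := tp i I; rewrite in_itv.
apply: fin_bigcap_measurable => // i _; apply: mf => //.
Qed.

End BorelMatrix.

(** * Iterated Lebesgue integrals *)

Section IteratedIntegral.
Context {R : realType}.
Local Open Scope ereal_scope.
Local Notation seqR := (nat -> R).
Local Notation upd y k x := (fun n => if n == k then x else y n).

(** Measurability is tested along coordinatewise measurable maps into sequences, so no sigma-algebra
    on [nat -> R] enters. Letting the source space vary makes the notion stable under integration of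
    one coordinate. *)
Definition coord_measurable (F : seqR -> \bar R) : Prop :=
  forall disp (T : measurableType disp) (a : T -> seqR),
    (forall n, measurable_fun setT (fun t => a t n)) ->
    measurable_fun setT (fun t => F (a t)).

Lemma coord_measurable_upd (F : seqR -> \bar R) (y : seqR) k :
  coord_measurable F -> measurable_fun setT (fun x : R => F (upd y k x)).
Proof.
by move=> mF; apply: mF => n /=; case: (n == k) => //; exact: measurable_cst.
Qed.

Lemma iint_ge0 k (F : seqR -> \bar R) y : (forall y, 0 <= F y) -> 0 <= iint k F y.
Proof. by move=> F0; elim: k y => //= k IH y; exact: integral_ge0. Qed.

Lemma coord_measurableN (F : seqR -> \bar R) : coord_measurable F ->
  coord_measurable (fun y => F^\+ y) /\ coord_measurable (fun y => F^\- y).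
Proof.
move=> mF; split=> disp T a ma.
- by have := measurable_funepos (mF _ _ _ ma); rewrite (funepos_comp F a).
- by have := measurable_funeneg (mF _ _ _ ma); rewrite (funeneg_comp F a).
Qed.

(** The variable of integration is adjoined to the parameter space, giving a map on [T * R] with
    measurable coordinates; Tonelli's theorem then applies to the positive and the negative part
    separately. *)
Lemma coord_measurable_iint k (F : seqR -> \bar R) :
  coord_measurable F -> coord_measurable (iint k F).
Proof.
move=> mF; elim: k => //= k IH disp T a ma.
have [mp mn] := coord_measurableN IH.
have mu : forall n, measurable_fun setT
   (fun p : T * R => (fun n => if n == k then p.2 else a p.1 n) n).
  move=> n /=; case: (n == k); first exact: measurable_snd.
  by apply: (measurableT_comp (ma n)); exact: measurable_fst.
rewrite (_ : (fun t => _) = (fun t =>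
    \int[@lebesgue_measure R]_x (iint k F)^\+ (upd (a t) k x) -
    \int[@lebesgue_measure R]_x (iint k F)^\- (upd (a t) k x))); last first.
  apply/funext => t; rewrite integralE.
  by rewrite (funepos_comp (iint k F) (fun x => upd (a t) k x))
    (funeneg_comp (iint k F) (fun x => upd (a t) k x)).
apply: emeasurable_funB.
- have := (@measurable_fun_fubini_tonelli_F _ _ T _ R (@lebesgue_measure R)
    (fun p : T * R => (iint k F)^\+ (upd (a p.1) k p.2))).
  by apply => //; exact: mp _ _ _ mu.
- have := (@measurable_fun_fubini_tonelli_F _ _ T _ R (@lebesgue_measure R)
    (fun p : T * R => (iint k F)^\- (upd (a p.1) k p.2))).
  by apply => //; exact: mn _ _ _ mu.
Qed.

Lemma le_iint k (F G : seqR -> \bar R) y :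
  (forall y, 0 <= F y) -> coord_measurable F -> coord_measurable G ->
  (forall y, F y <= G y) -> iint k F y <= iint k G y.
Proof.
move=> F0 mF mG FG; have G0 z : 0 <= G z by exact: le_trans (FG z).
elim: k y => //= k IH y; apply: ge0_le_integral => //.
- by move=> x _; exact: iint_ge0.
- apply: coord_measurable_upd; exact: coord_measurable_iint.
- apply: coord_measurable_upd; exact: coord_measurable_iint.
Qed.

Lemma iintD k (F G : seqR -> \bar R) y :
  (forall y, 0 <= F y) -> coord_measurable F ->
  (forall y, 0 <= G y) -> coord_measurable G ->
  iint k (fun y => F y + G y) y = iint k F y + iint k G y.
Proof.
move=> F0 mF G0 mG; elim: k y => //= k IH y.
under eq_integral do rewrite IH.
rewrite ge0_integralD //.
- by move=> x _; exact: iint_ge0.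
- apply: coord_measurable_upd; exact: coord_measurable_iint.
- by move=> x _; exact: iint_ge0.
- apply: coord_measurable_upd; exact: coord_measurable_iint.
Qed.

Lemma iintZl k (c : R) (F : seqR -> \bar R) y : (0 <= c)%R ->
  (forall y, 0 <= F y) -> coord_measurable F ->
  iint k (fun y => c%:E * F y) y = c%:E * iint k F y.
Proof.
move=> c0 F0 mF; elim: k y => //= k IH y.
under eq_integral do rewrite IH.
rewrite ge0_integralZl_EFin //.
- by move=> x _; exact: iint_ge0.
- apply: coord_measurable_upd; exact: coord_measurable_iint.
Qed.

Lemma iint_monotone_cvg k (F : nat -> seqR -> \bar R) y :
  (forall n y, 0 <= F n y) -> (forall n, coord_measurable (F n)) ->
  (forall y, nondecreasing_seq (F ^~ y)) ->
  iint k (fun y => limn (F ^~ y)) y = limn (fun n => iint k (F n) y).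
Proof.
move=> F0 mF ndF; elim: k y => //= k IH y.
under eq_integral do rewrite IH.
rewrite monotone_convergence //.
- by move=> n; apply: coord_measurable_upd; exact: coord_measurable_iint.
- by move=> n x _; exact: iint_ge0.
- by move=> x _ m n mn; apply: le_iint => // z; exact: ndF.
Qed.

(* An inner integral may be the undefined [+oo - +oo], but only on a null set. *)
Lemma iint_signed k (F : seqR -> \bar R) y :
  coord_measurable F -> iint k (fun y => `|F y|) y < +oo ->
  iint k F y = iint k F^\+ y - iint k F^\- y.
Proof.
move=> mF; have [mp mn] := coord_measurableN mF.
have ma : coord_measurable (fun y => `|F y|).
  by move=> disp T a aP; apply: measurableT_comp (mF _ _ _ aP).
elim: k y => [|k IH] y /=; first by move=> _; rewrite {1}(funeposneg F).
move=> finF.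
have mk G : coord_measurable G -> measurable_fun setT (fun x => iint k G (upd y k x)).
  by move=> mG; apply: coord_measurable_upd; exact: coord_measurable_iint.
have iabs : (@lebesgue_measure R).-integrable setT
    (fun x => iint k (fun y => `|F y|) (upd y k x)).
  apply/integrableP; split; first exact: mk.
  by under eq_integral do rewrite gee0_abs ?iint_ge0//.
have ip : (@lebesgue_measure R).-integrable setT
    (fun x => iint k F^\+ (upd y k x)).
  apply: (le_integrable _ _ _ iabs) => //; first exact: mk.
  move=> x _; rewrite !gee0_abs ?iint_ge0//; apply: le_iint => // z.
  by rewrite -/((abse \o F) z) fune_abse leeDl.
have ineg : (@lebesgue_measure R).-integrable setT
    (fun x => iint k F^\- (upd y k x)).
  apply: (le_integrable _ _ _ iabs) => //; first exact: mk.
  move=> x _; rewrite !gee0_abs ?iint_ge0//; apply: le_iint => // z.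
  by rewrite -/((abse \o F) z) fune_abse leeDr.
rewrite -integralB //; apply: ae_eq_integral => //; first exact: mk.
  by apply: emeasurable_funB; exact: mk.
(* A finite outer integral makes the inner integral of the absolute value finite for almost every
   [x], and there the induction hypothesis applies. *)
have := integrable_ae measurableT iabs; apply: filterS => x /= /(_ I) finx _.
by apply: IH; move: finx; rewrite ge0_fin_numE ?iint_ge0.
Qed.

End IteratedIntegral.

(** * Densities and nonnegative functionals *)

Section NonnegFunctional.
Context {R : realType} {disp : measure_display} {T : measurableType disp}.
Local Open Scope ereal_scope.

(** A common interface for integrals against a measure and for iterated integrals weighted by a
    density; the latter can thus be compared with the former without being turned into a measure. *)
Definition nonneg_functional (Phi : (T -> \bar R) -> \bar R) : Prop :=
  [/\ (forall f g, (forall x, 0 <= f x) -> measurable_fun setT f ->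
         (forall x, 0 <= g x) -> measurable_fun setT g ->
         Phi (fun x => f x + g x) = Phi f + Phi g),
      (forall (c : R) f, (0 <= c)%R -> (forall x, 0 <= f x) -> measurable_fun setT f ->
         Phi (fun x => c%:E * f x) = c%:E * Phi f) &
      (forall F : nat -> T -> \bar R, (forall n x, 0 <= F n x) ->
         (forall n, measurable_fun setT (F n)) ->
         (forall x, nondecreasing_seq (F ^~ x)) ->
         Phi (fun x => limn (F ^~ x)) = limn (fun n => Phi (F n)))].

Lemma nonneg_functional0 (Phi : (T -> \bar R) -> \bar R) :
  nonneg_functional Phi -> Phi (fun=> 0) = 0.
Proof.
move=> [_ PhiZ _].
have := PhiZ 0%R (cst 0) (lexx _) (fun=> lexx _) (measurable_cst _).
rewrite mul0e => E; rewrite -[RHS]E; congr Phi.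
by apply/funext => x; rewrite mul0e.
Qed.

Import HBNNSimple.

(** A simple function is a finite nonnegative combination of indicators, and a nonnegative
    measurable function is an increasing limit of simple ones. *)
Lemma nonneg_functional_ext (Phi Psi : (T -> \bar R) -> \bar R) :
  nonneg_functional Phi -> nonneg_functional Psi ->
  (forall A, measurable A ->
     Phi (fun x => (\1_A x)%:E) = Psi (fun x => (\1_A x)%:E)) ->
  forall f, (forall x, 0 <= f x) -> measurable_fun setT f -> Phi f = Psi f.
Proof.
move=> Phif Psif Ind.
have [[PhiD PhiZ PhiL] [PsiD PsiZ PsiL]] := (Phif, Psif).
have simple (g : {nnsfun T >-> R}) : Phi (EFin \o g) = Psi (EFin \o g).
  pose r : seq R := finmap.enum_fset (fset_set (range g)).
  have -> : EFin \o g = fun x => \sum_(y <- r)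
      (y%:E * (\1_(g @^-1` [set y]) x)%:E).
    apply/funext => x /=; rewrite {1}fimfunE fsbig_finite //= -sumEFin.
    by apply: eq_bigr => y _; rewrite EFinM.
  have : forall y, y \in r -> (0 <= y)%R.
    by move=> y; rewrite /r in_fset_set// inE => -[x _ <-].
  elim: r => [_|y s IH s0].
    under eq_fun do rewrite big_nil.
    by rewrite !nonneg_functional0.
  have y0 : (0 <= y)%R by apply: s0; rewrite inE eqxx.
  have s0' z : z \in s -> (0 <= z)%R by move=> zs; apply: s0; rewrite inE zs orbT.
  have mi : measurable_fun setT (fun x => (\1_(g @^-1` [set y]) x)%:E : \bar R).
    by apply/measurable_EFinP; exact: measurable_indic.
  have i0 x : 0 <= (\1_(g @^-1` [set y]) x)%:E :> \bar R by rewrite lee_fin.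
  have si x : 0 <= \sum_(y <- s) (y%:E * (\1_(g @^-1` [set y]) x)%:E) :> \bar R.
    by rewrite big_seq; apply: sume_ge0 => z zs; apply: mule_ge0;
      rewrite lee_fin//; exact: s0'.
  have ms : measurable_fun setT (fun x =>
      \sum_(y <- s) (y%:E * (\1_(g @^-1` [set y]) x)%:E) : \bar R).
    apply: emeasurable_sum => z; apply: measurable_funeM.
    by apply/measurable_EFinP; exact: measurable_indic.
  under eq_fun do rewrite big_cons.
  rewrite PhiD//; last 2 first.
  - by move=> x; rewrite mule_ge0 ?lee_fin.
  - exact: measurable_funeM.
  rewrite PsiD//; last 2 first.
  - by move=> x; rewrite mule_ge0 ?lee_fin.
  - exact: measurable_funeM.
  by rewrite PhiZ// PsiZ// Ind// IH.
move=> f f0 mf; pose g := nnsfun_approx measurableT mf.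
have -> : f = fun x => limn (fun n => (EFin \o g n) x).
  apply/funext => x; apply/esym/cvg_lim => //.
  exact: cvg_nnsfun_approx.
have nd x : nondecreasing_seq (fun n => (EFin \o g n) x).
  by move=> m n mn; rewrite lee_fin; exact/lefP/nd_nnsfun_approx.
have g0 n x : 0 <= (EFin \o g n) x by rewrite lee_fin.
have mg n : measurable_fun setT (EFin \o g n) by exact/measurable_EFinP.
by rewrite PhiL// PsiL//; under eq_fun do rewrite simple.
Qed.

End NonnegFunctional.

(** Integration against the image under [X] of the measure with density [w]. The weight 1 gives the
    law of the position; the positive and negative parts of a difference serve as weights for
    conditional expectations. *)
Lemma nonneg_functional_integral {R : realType} d1 d2 (S : measurableType d1)
    (T : measurableType d2) (mu : {measure set S -> \bar R}) (X : S -> T) (w : S -> R) :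
  measurable_fun setT X -> (forall z, 0 <= w z) -> measurable_fun setT w ->
  nonneg_functional (fun f : T -> \bar R => \int[mu]_z ((w z)%:E * f (X z)))%E.
Proof.
move=> mX w0 mw.
have ge0 (f : T -> \bar R) z : (forall x, 0 <= f x)%E -> (0 <= (w z)%:E * f (X z))%E.
  by move=> f0; rewrite mule_ge0 ?lee_fin.
have mf (f : T -> \bar R) : measurable_fun setT f ->
    measurable_fun setT (fun z => (w z)%:E * f (X z))%E.
  move=> mf; apply: emeasurable_funM; first exact/measurable_EFinP.
  exact: measurableT_comp mf mX.
split.
- move=> f g f0 mf' g0 mg'.
  under eq_integral do rewrite ge0_muleDr//.
  by rewrite ge0_integralD// => [z _||z _|]; [exact: ge0|exact: mf|exact: ge0|exact: mf].
- move=> c f c0 f0 mf'.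
  under eq_integral do rewrite muleCA.
  by rewrite ge0_integralZl_EFin// => [z _|]; [exact: ge0|exact: mf].
- move=> F F0 mF ndF.
  rewrite -monotone_convergence//.
  + apply: eq_integral => z _; apply/esym/cvg_lim => //.
    by apply: cvgeZl => //; exact: ereal_nondecreasing_is_cvgn.
  + by move=> n; exact: mf.
  + by move=> n z _; exact: ge0.
  + by move=> z _ m n mn; apply: lee_wpmul2l; [rewrite lee_fin|exact: ndF].
Qed.

(** * Integration against the density of the position *)

Section Lebint.
Context {R : realType} {d : nat}.
Local Notation V := 'rV[R]_d.
Local Open Scope ereal_scope.

Lemma coord_measurable_row (f : V -> \bar R) : measurable_fun setT f ->
  coord_measurable (fun y : nat -> R => f (\row_(i < d) y i)%R).
Proof.
move=> mf disp T a ma; apply: (measurableT_comp mf); apply: measurable_fun_rV => i.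
by under eq_fun do rewrite mxE; exact: ma.
Qed.

Lemma nonneg_functional_lebint (rho : V -> R) :
  (forall x, 0 <= rho x)%R -> measurable_fun setT rho ->
  nonneg_functional (fun g : V -> \bar R => lebint (fun x => (rho x)%:E * g x)).
Proof.
move=> r0 mr.
have ge0 (g : V -> \bar R) x : (forall x, 0 <= g x) -> 0 <= (rho x)%:E * g x.
  by move=> g0; rewrite mule_ge0 ?lee_fin.
have mf (g : V -> \bar R) : measurable_fun setT g ->
    coord_measurable (fun y : nat -> R =>
      (rho (\row_(i < d) y i)%R)%:E * g (\row_(i < d) y i)%R).
  move=> mg; apply: (@coord_measurable_row (fun x => (rho x)%:E * g x)).
  by apply: emeasurable_funM => //; exact/measurable_EFinP.
split.
- move=> f g f0 mf' g0 mg'; rewrite /lebint -iintD//.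
  + by congr iint; apply/funext => y; rewrite ge0_muleDr.
  + by move=> y; exact: ge0.
  + exact: mf.
  + by move=> y; exact: ge0.
  + exact: mf.
- move=> c f c0 f0 mf'; rewrite /lebint -iintZl//.
  + by congr iint; apply/funext => y; rewrite muleCA.
  + by move=> y; exact: ge0.
  + exact: mf.
- move=> F F0 mF ndF; rewrite /lebint -iint_monotone_cvg//.
  + congr iint; apply/funext => y; apply/esym/cvg_lim => //.
    by apply: cvgeZl => //; exact: ereal_nondecreasing_is_cvgn.
  + by move=> n y; exact: ge0.
  + by move=> n; exact: mf.
  + by move=> y m n mn; apply: lee_wpmul2l; [rewrite lee_fin|exact: ndF].
Qed.

Lemma measurable_Xt (t : R) : measurable_fun setT (@Xt R d t).
Proof.
apply: measurable_fun_rV => i; rewrite /Xt.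
under eq_fun do rewrite !mxE.
apply: measurable_funD; apply: measurable_funM => //.
- exact: (measurableT_comp (measurable_mx_coord ord0 i) measurable_fst).
- exact: (measurableT_comp (measurable_mx_coord ord0 i) measurable_snd).
Qed.

Variables (gamma : probability (V * V)%type R) (t : R) (rho : V -> R).
Hypothesis rhoP : is_density gamma t rho.

(** Both sides are nonnegative functionals of [g], and [is_density] says that they agree on
    indicators. *)
Lemma ge0_lebint_density (g : V -> \bar R) :
  (forall x, 0 <= g x) -> measurable_fun setT g ->
  lebint (fun x => (rho x)%:E * g x) = \int[gamma]_z g (Xt t z).
Proof.
case: rhoP => r0 [mr rI] g0 mg.
have N := nonneg_functional_lebint r0 mr.
have N' := nonneg_functional_integral gamma (measurable_Xt t)
  (w := fun=> 1%R) (fun=> ler01) (measurable_cst _).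
rewrite (nonneg_functional_ext N N' _ g0 mg).
  by under eq_integral do rewrite mul1e.
move=> A mA; rewrite -rI//.
under eq_integral do rewrite mul1e.
by rewrite (integral_indic gamma measurableT (A := Xt t @^-1` A)) ?setIT//
  -[X in measurable X]setTI; exact: measurable_Xt.
Qed.

Lemma lebint_density (g : V -> R) :
  measurable_fun setT g -> gamma.-integrable setT (fun z => (g (Xt t z))%:E) ->
  lebint (fun x => (rho x * g x)%:E) = \int[gamma]_z (g (Xt t z))%:E.
Proof.
case: (rhoP) => r0 [mr rI] mg ig.
have mG : measurable_fun setT (EFin \o g) by exact/measurable_EFinP.
have mF : measurable_fun setT (fun x => (rho x * g x)%:E).
  by apply/measurable_EFinP; exact: measurable_funM.
rewrite /lebint iint_signed.
- rewrite [RHS]integralE; congr (_ - _).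
  + rewrite (funepos_comp (EFin \o g) (Xt t))
      -ge0_lebint_density//; last exact: measurable_funepos.
    congr iint; apply/funext => y; rewrite !funeposE maxe_pMr ?lee_fin//.
    by rewrite mule0.
  + rewrite (funeneg_comp (EFin \o g) (Xt t))
      -ge0_lebint_density//; last exact: measurable_funeneg.
    congr iint; apply/funext => y; rewrite !funenegE maxe_pMr ?lee_fin//.
    by rewrite mule0 muleN.
- exact: (coord_measurable_row mF).
(* Integrability under [gamma] passes through the nonnegative case to finiteness of the iterated
   integral of the absolute value, which the splitting requires. *)
- have := ge0_lebint_density (fun x => abse_ge0 (g x)%:E)
    (measurableT_comp (@abse_measurable _ _) mG).
  rewrite /lebint => E.
  under [X in iint _ X]eq_fun do rewrite EFinM abseM gee0_abs ?lee_fin//.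
  rewrite E//; by case/integrableP: ig.
Qed.

End Lebint.

(** * Conditional expectations *)

Section ConditionalExpectation.
Context {R : realType} {d1 d2 : measure_display}.
Context {S : measurableType d1} {T : measurableType d2}.
Variables (mu : probability S R) (X : S -> T).
Hypothesis mX : measurable_fun setT X.

Lemma integrable_le (f g : S -> R) : measurable_fun setT f ->
  mu.-integrable setT (EFin \o g) -> (forall z, `|f z| <= g z) ->
  mu.-integrable setT (EFin \o f).
Proof.
move=> mf ig fg; apply: (le_integrable measurableT _ _ ig).
  exact/measurable_EFinP.
by move=> z _ /=; rewrite lee_fin (le_trans (fg z))// ler_norm.
Qed.

Variables (f1 f2 : S -> R).
Hypotheses (if1 : mu.-integrable setT (EFin \o f1))
           (if2 : mu.-integrable setT (EFin \o f2)).
Hypothesis f12 : forall A : set T, measurable A ->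
  (\int[mu]_z (f1 z * \1_A (X z))%:E = \int[mu]_z (f2 z * \1_A (X z))%:E)%E.

Let mf1 : measurable_fun setT f1.
Proof. by apply/measurable_EFinP; case/integrableP: if1. Qed.
Let mf2 : measurable_fun setT f2.
Proof. by apply/measurable_EFinP; case/integrableP: if2. Qed.

Let mA (A : set T) : measurable A -> measurable_fun setT (fun z => \1_A (X z) : R).
Proof. by move=> mA; have := measurableT_comp (@measurable_indic _ T R setT A mA) mX. Qed.

Let iA (f : S -> R) A : measurable A -> mu.-integrable setT (EFin \o f) ->
  mu.-integrable setT (EFin \o (fun z => f z * \1_A (X z))).
Proof.
move=> mA' fi; have mf : measurable_fun setT f by apply/measurable_EFinP; case/integrableP: fi.
apply: (@integrable_le _ (fun z => `|f z|)).
- by apply: measurable_funM => //; exact: mA.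
- exact: integrable_norm.
- by move=> z; rewrite normrM ler_piMr// indicE; case: (_ \in _); rewrite ?normr1 ?normr0.
Qed.

(** The difference [f = f1 - f2] integrates to 0 over every event of [X], so the measures with
    densities [fp] and [fn] have the same image under [X] and integrate every nonnegative function
    of [X] alike. Applying this to [gp] and [gn] and recombining the four products gives the
    claim. *)
Lemma cond_expectation_pull_out (g : T -> R) : measurable_fun setT g ->
  mu.-integrable setT (EFin \o (fun z => f1 z * g (X z))) ->
  mu.-integrable setT (EFin \o (fun z => f2 z * g (X z))) ->
  (\int[mu]_z (f1 z * g (X z))%:E = \int[mu]_z (f2 z * g (X z))%:E)%E.
Proof.
move=> mg i1 i2.
pose f z := f1 z - f2 z.
have mf : measurable_fun setT f by exact: measurable_funB.
pose fp z := Num.max (f z) 0; pose fn z := Num.max (- f z) 0.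
pose gp z := Num.max (g z) 0; pose gn z := Num.max (- g z) 0.
have mfp : measurable_fun setT fp by apply: measurable_maxr.
have mfn : measurable_fun setT fn.
  by apply: measurable_maxr => //; exact: measurable_funN.
have mgp : measurable_fun setT gp by apply: measurable_maxr.
have mgn : measurable_fun setT gn.
  by apply: measurable_maxr => //; exact: measurable_funN.
have fp0 z : 0 <= fp z by rewrite /fp le_max lexx orbT.
have fn0 z : 0 <= fn z by rewrite /fn le_max lexx orbT.
have gp0 z : 0 <= gp z by rewrite /gp le_max lexx orbT.
have gn0 z : 0 <= gn z by rewrite /gn le_max lexx orbT.
have fE z : f z = fp z - fn z.
  by rewrite /fp /fn; case: (leP (f z) 0) => ?; case: (leP (- f z) 0) => ?; lra.
have gE z : g z = gp z - gn z.
  by rewrite /gp /gn; case: (leP (g z) 0) => ?; case: (leP (- g z) 0) => ?; lra.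
have fnE z : `|f z| = fp z + fn z.
  rewrite /fp /fn; case: (leP (f z) 0) => h; case: (leP (- f z) 0) => ?;
    first [rewrite (ler0_norm h)|rewrite (gtr0_norm h)]; lra.
have gnE z : `|g z| = gp z + gn z.
  rewrite /gp /gn; case: (leP (g z) 0) => h; case: (leP (- g z) 0) => ?;
    first [rewrite (ler0_norm h)|rewrite (gtr0_norm h)]; lra.
have if_ : mu.-integrable setT (EFin \o f).
  by have := integrableB measurableT if1 if2; apply: eq_integrable.
have ifp : mu.-integrable setT (EFin \o fp).
  apply: (@integrable_le _ (fun z => `|f z|)) => //; first exact: integrable_norm.
  by move=> z; rewrite ger0_norm// fnE lerDl.
have ifn : mu.-integrable setT (EFin \o fn).
  apply: (@integrable_le _ (fun z => `|f z|)) => //; first exact: integrable_norm.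
  by move=> z; rewrite ger0_norm// fnE lerDr.
have key (h : T -> R) : (forall x, 0 <= h x) -> measurable_fun setT h ->
    (\int[mu]_z (fp z * h (X z))%:E = \int[mu]_z (fn z * h (X z))%:E)%E.
  move=> h0 mh.
  have Np := nonneg_functional_integral mu mX fp0 mfp.
  have Nn := nonneg_functional_integral mu mX fn0 mfn.
  apply: (nonneg_functional_ext Np Nn _ (f := EFin \o h)); last first.
  - exact/measurable_EFinP.
  - by move=> x /=; rewrite lee_fin.
  - move=> A mA'.
    have sub0 : (\int[mu]_z (fp z * \1_A (X z))%:E - \int[mu]_z (fn z * \1_A (X z))%:E = 0)%E.
      rewrite -integralB_EFin//; [|exact: iA|exact: iA].
      transitivity (\int[mu]_z ((f1 z * \1_A (X z))%:E - (f2 z * \1_A (X z))%:E))%E.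
        apply: eq_integral => z _; rewrite -!EFinB; congr EFin.
        by rewrite -!mulrBl -fE.
      rewrite integralB_EFin//; [|exact: iA|exact: iA].
      by rewrite f12// subee//; apply: integrable_fin_num => //; exact: iA.
    move/eqP: sub0; rewrite sube_eq ?add0e.
    + by move/eqP.
    + by apply: integrable_fin_num => //; exact: iA.
    + rewrite fin_num_adde_defl//; apply: integrable_fin_num => //; exact: iA.
have mgX h : measurable_fun setT h -> measurable_fun setT (fun z => h (X z) : R).
  by move=> mh; exact: (measurableT_comp mh mX).
(* [P] and [N] collect the positive and the negative products in [(fp - fn) (gp - gn)]. Both are
   bounded by [|f g|], hence integrable, so their integrals may be subtracted. *)
pose P z := fp z * gp (X z) + fn z * gn (X z).
pose N z := fp z * gn (X z) + fn z * gp (X z).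
have mP : measurable_fun setT P.
  by apply: measurable_funD; apply: measurable_funM => //; exact: mgX.
have mN : measurable_fun setT N.
  by apply: measurable_funD; apply: measurable_funM => //; exact: mgX.
have ifg : mu.-integrable setT (EFin \o (fun z => f z * g (X z))).
  have := integrableB measurableT i1 i2; apply: eq_integrable => // z _ /=.
  by rewrite -EFinB -mulrBl.
have PN z : `|f z * g (X z)| = P z + N z.
  by rewrite normrM fnE gnE /P /N; ring.
have P0 z : 0 <= P z by rewrite addr_ge0// mulr_ge0.
have N0 z : 0 <= N z by rewrite addr_ge0// mulr_ge0.
have iP : mu.-integrable setT (EFin \o P).
  apply: (@integrable_le _ (fun z => `|f z * g (X z)|)) => //; first exact: integrable_norm.
  by move=> z; rewrite PN ger0_norm// lerDl.
have iN : mu.-integrable setT (EFin \o N).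
  apply: (@integrable_le _ (fun z => `|f z * g (X z)|)) => //; first exact: integrable_norm.
  by move=> z; rewrite PN ger0_norm// lerDr.
have intPN : (\int[mu]_z (P z)%:E = \int[mu]_z (N z)%:E)%E.
  have mm (a : S -> R) (b : T -> R) : measurable_fun setT a -> measurable_fun setT b ->
      measurable_fun setT (fun z => (a z * b (X z))%:E).
    by move=> ? ?; apply/measurable_EFinP; apply: measurable_funM => //; exact: mgX.
  rewrite /P /N.
  under eq_integral do rewrite EFinD.
  under [RHS]eq_integral do rewrite EFinD.
  rewrite !ge0_integralD//; try (by move=> z _; rewrite lee_fin mulr_ge0); try exact: mm.
  by rewrite (key gp)// (key gn)// addeC.
have : (\int[mu]_z (f z * g (X z))%:E = 0)%E.
  transitivity (\int[mu]_z ((P z)%:E - (N z)%:E))%E.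
    apply: eq_integral => z _; rewrite -EFinB; congr EFin.
    by rewrite fE gE /P /N; ring.
  by rewrite integralB_EFin// intPN subee//; apply: integrable_fin_num.
under eq_integral do rewrite mulrBl EFinB.
rewrite integralB_EFin// => /eqP; rewrite sube_eq ?add0e.
- by move/eqP.
- exact: integrable_fin_num.
- by rewrite fin_num_adde_defl//; exact: integrable_fin_num.
Qed.

(** When every event is almost surely an event of [X], the hypothesis on [f1] and [f2] compares
    their integrals over all events. *)
Lemma cond_expectation_ae_eq :
  (forall E, measurable E -> exists2 A : set T, measurable A &
     {ae mu, forall z, E z <-> A (X z)}) ->
  {ae mu, forall z, f1 z = f2 z}.
Proof.
move=> sat.
have : ae_eq mu setT (EFin \o f1) (EFin \o f2).
  apply: integral_ae_eq => //; first exact/measurable_EFinP.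
  move=> E _ mE; have [A mA' EA] := sat E mE.
  have restr (f : S -> R) : mu.-integrable setT (EFin \o f) ->
      (\int[mu]_(z in E) (f z)%:E = \int[mu]_z (f z * \1_A (X z))%:E)%E.
    move=> fi; have mf : measurable_fun setT f by apply/measurable_EFinP; case/integrableP: fi.
    rewrite integral_mkcond; apply: ae_eq_integral => //.
    - by apply/(measurable_restrictT _ mE); apply/measurable_EFinP; exact: measurable_funS mf.
    - by apply/measurable_EFinP; apply: measurable_funM => //; exact: mA.
    - apply: filterS EA => z EA _; rewrite patchE indicE.
      case: ifPn => [/set_mem zE|/negP zE].
        by rewrite mem_set ?mulr1//; exact/EA.
      by rewrite memNset ?mulr0// => /EA/mem_set.
  by rewrite !restr// f12.
by apply: filterS => z /(_ I) /= [].
Qed.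

End ConditionalExpectation.

(** * Processes determined by their position at time t *)

Section InjectiveImage.
Context {R : realType} {d : nat}.
Local Notation V := 'rV[R]_d.

(* Closed sets are sigma-compact, so their images are F_sigma; injectivity
   makes images commute with complements. *)
Lemma measurable_injective_image (f : V -> V) (K : set V) :
  continuous f -> closed K -> {in K &, injective f} ->
  forall B : set V, measurable B -> measurable (f @` (B `&` K)).
Proof.
move=> cf cK injf.
have closedP (C : set V) : closed C -> measurable (f @` (C `&` K)).
  move=> cC.
  have -> : C `&` K = \bigcup_n ((C `&` K) `&` [set x | `|x| <= n%:R]).
    apply/seteqP; split=> [x CKx|x [n _ [] //]].
    have [n xn] : exists n, `|x| <= n%:R :> R.
      by exists (Num.truncn `|x|).+1; rewrite ltW// truncnS_gt.
    by exists n.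
  rewrite image_bigcup; apply: bigcupT_measurable => n.
  apply: measurable_closed_mx; apply: compact_closed; first exact: norm_hausdorff.
  apply: continuous_compact; first exact: continuous_subspaceT.
  apply: bounded_closed_compact.
    exists n%:R; split; first exact: num_real.
    by move=> M nM x [_ /= xn]; apply: le_trans xn (ltW nM).
  apply: closedI; first exact: closedI.
  have -> : [set x : V | `|x| <= n%:R] = (@Num.norm R V) @^-1` [set r : R | r <= n%:R] by [].
  by apply: closed_comp; [move=> x _; exact: norm_continuous|exact: closed_le].
move=> B; apply: (@smallest_sub _ (sigma_algebra setT) (@open V)
  [set B | measurable (f @` (B `&` K))]).
  split=> /=.
  - by rewrite set0I image_set0; exact: measurable0.
  - move=> A mA.
    have -> : f @` ((setT `\` A) `&` K) = f @` (setT `&` K) `\` f @` (A `&` K).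
      apply/seteqP; split=> y.
        move=> [x [[_ nA] Kx] <-]; split; first by exists x.
        move=> [x' [Ax' Kx'] /injf xx']; apply: nA; rewrite -xx'//; exact/mem_set.
      move=> [[x [_ Kx] <-] nA]; exists x => //; split=> //; split=> // Ax.
      by apply: nA; exists x.
    by apply: measurableD => //; exact: closedP closedT.
  - move=> F mF; rewrite setI_bigcupl image_bigcup; exact: bigcupT_measurable.
move=> U oU /=.
have -> : f @` (U `&` K) = f @` (setT `&` K) `\` f @` ((~` U) `&` K).
  apply/seteqP; split=> y.
    move=> [x [Ux Kx] <-]; split; first by exists x.
    move=> [x' [Ax' Kx'] /injf xx']; apply: Ax'; rewrite xx'//; exact/mem_set.
  move=> [[x [_ Kx] <-] nA]; exists x => //; split=> //; apply: contrapT => nU.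
  by apply: nA; exists x.
by apply: measurableD; apply: closedP; [exact: closedT|exact: open_closedC].
Qed.

End InjectiveImage.

(** * Second moments of the position and of the velocity *)

Section Moments.
Context {R : realType} {d : nat}.
Local Notation V := 'rV[R]_d.
Variable gamma : probability (V * V)%type R.

Lemma sqnorm_ge0 (u : V) : 0 <= sqnorm u.
Proof. by apply: sumr_ge0 => i _; rewrite -expr2 sqr_ge0. Qed.

Lemma sqr_coord_le (u : V) i : u ord0 i ^+ 2 <= sqnorm u.
Proof.
rewrite /sqnorm /dotv (bigD1 i)//= -expr2 lerDl.
by apply: sumr_ge0 => j _; rewrite -expr2 sqr_ge0.
Qed.

Lemma measurable_sqnorm : measurable_fun setT (@sqnorm R d).
Proof.
by apply: measurable_sum => i; apply: measurable_funM; exact: measurable_mx_coord.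
Qed.

Lemma measurable_Xdot i : measurable_fun setT (fun z : V * V => Xdot z ord0 i).
Proof.
rewrite /Xdot; under eq_fun do rewrite !mxE.
apply: measurable_funB.
- exact: (measurableT_comp (measurable_mx_coord ord0 i) measurable_snd).
- exact: (measurableT_comp (measurable_mx_coord ord0 i) measurable_fst).
Qed.

Hypothesis fin2 : forall t, 0 <= t <= 1 ->
  (\int[gamma]_z (sqnorm (Xt t z))%:E < +oo)%E.

Lemma integrable_sqnorm_Xt t : 0 <= t <= 1 ->
  gamma.-integrable setT (EFin \o (fun z => sqnorm (Xt t z))).
Proof.
move=> /fin2 fint; apply/integrableP; split.
  by apply/measurable_EFinP; exact: (measurableT_comp measurable_sqnorm (measurable_Xt t)).
by under eq_integral do rewrite /= ger0_norm ?sqnorm_ge0//.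
Qed.

(** The endpoints [X_0] and [X_1] are the positions at times 0 and 1. With [a], [b] coordinates of
    [X_0] and [c], [e] those of [X_1], the bound is [|(c - a)(e - b)| <= a^2 + b^2 + c^2 + e^2], and
    each square is at most one of the two squared norms; whence the factor 2. *)
Lemma integrable_XdotM i j : gamma.-integrable setT
  (EFin \o (fun z : V * V => Xdot z ord0 i * Xdot z ord0 j)).
Proof.
have i0 := @integrable_sqnorm_Xt 0 _; have i1 := @integrable_sqnorm_Xt 1 _.
have := integrableD measurableT (i0 _) (i1 _); rewrite !lexx !ler01 => /(_ isT isT).
move=> /(integrableZl measurableT 2) iG.
apply: (@integrable_le _ _ _ gamma _
  (fun z => 2 * (sqnorm (Xt 0 z) + sqnorm (Xt 1 z)))); [|exact: iG|].
  by apply: measurable_funM; exact: measurable_Xdot.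
move=> z; rewrite /Xt /Xdot !mxE subr0 subrr !scale0r !scale1r addr0 add0r.
have := sqr_coord_le z.1 i; have := sqr_coord_le z.1 j.
have := sqr_coord_le z.2 i; have := sqr_coord_le z.2 j.
move: (z.1 ord0 i) (z.1 ord0 j) (z.2 ord0 i) (z.2 ord0 j) => a b c e.
move: (sqnorm z.1) (sqnorm z.2) => A B h1 h2 h3 h4.
have := sqr_ge0 ((c - a) + (e - b)); have := sqr_ge0 ((c - a) - (e - b)).
have := sqr_ge0 (c + a); have := sqr_ge0 (e + b).
by rewrite ler_norml => *; apply/andP; split; lra.
Qed.

Lemma integrable_Xdot j : gamma.-integrable setT
  (EFin \o (fun z : V * V => Xdot z ord0 j)).
Proof.
have i1 : gamma.-integrable setT (EFin \o cst (1 : R)).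
  exact: finite_measure_integrable_cst.
have iG := integrableD measurableT i1 (integrable_XdotM j j).
apply: (@integrable_le _ _ _ gamma _
  (fun z => 1 + Xdot z ord0 j * Xdot z ord0 j)); [|exact: iG|].
  exact: measurable_Xdot.
move=> z /=; move: (Xdot z ord0 j) => a; rewrite ler_norml; apply/andP; split; nra.
Qed.

End Moments.

Lemma continuous_coord {R : realType} (U : topologicalType) d (f : U -> 'rV[R]_d) i :
  continuous f -> continuous (fun x => f x ord0 i).
Proof.
move=> cf x.
by have := continuous_comp (cf x) (@coord_continuous R 1 d ord0 i (f x)); apply.
Qed.

Lemma continuous_measurable_rV {R : realType} d (f : 'rV[R]_d -> 'rV[R]_d) :
  continuous f -> measurable_fun setT f.
Proof.
move=> cf; apply: measurable_fun_rV => i; apply: continuous_measurable_mx.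
exact: continuous_coord.
Qed.

(** * Transport maps that are monotone on a closed set of full measure *)

Section Determined.
Context {R : realType} {d : nat}.
Local Notation V := 'rV[R]_d.
Variables (P0 : probability V R) (gamma : probability (V * V)%type R).
Variables (rho : V -> R) (vt : V -> V) (Ct : V -> 'M[R]_d) (t : R).
Hypothesis t01 : 0 <= t < 1.
Hypothesis rhoP : is_density gamma t rho.
Hypothesis vP : is_cond_velocity gamma t vt.
Hypothesis CP : is_cond_second_moment gamma t Ct.
Hypothesis fin2 : forall t, 0 <= t <= 1 ->
  (\int[gamma]_z (sqnorm (Xt t z))%:E < +oo)%E.

Lemma measurable_Pi i j : measurable_fun setT (fun x => Pi Ct vt x i j).
Proof.
case: vP => mv _; case: CP => mC _.
rewrite /Pi /outer; under eq_fun do rewrite !mxE.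
apply: measurable_funB; first exact: (measurableT_comp (measurable_mx_coord i j) mC).
by apply: measurable_funM;
  [exact: (measurableT_comp (measurable_mx_coord ord0 i) mv)
  |exact: (measurableT_comp (measurable_mx_coord ord0 j) mv)].
Qed.

Lemma measurable_partial (phi : V -> V) i j : smooth phi ->
  measurable_fun setT (partial i j phi).
Proof.
move=> /(_ [:: ebasis R i]) [/= cphi _].
rewrite /partial; apply: continuous_measurable_mx.
exact: continuous_coord.
Qed.

(** Through the density, the tested integral becomes the expectation at [X_t] of the contraction of
    [Pi] with the derivative of the test field, and this variable vanishes almost surely. *)
Lemma div_rhoPi_zero_ae :
  {ae gamma, forall z, forall ij : 'I_d * 'I_d, Pi Ct vt (Xt t z) ij.1 ij.2 = 0} ->
  div_rhoPi_zero rho (Pi Ct vt).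
Proof.
move=> Pi0 phi [sphi _].
set g := fun x => \sum_(i < d) \sum_(j < d) Pi Ct vt x i j * partial i j phi x.
have mg : measurable_fun setT g.
  apply: measurable_sum => i; apply: measurable_sum => j.
  by apply: measurable_funM; [exact: measurable_Pi|exact: measurable_partial].
have mgX : measurable_fun setT (fun z => (g (Xt t z))%:E).
  by apply/measurable_EFinP; exact: (measurableT_comp mg (measurable_Xt t)).
have g0 : ae_eq gamma setT (fun z => (g (Xt t z))%:E) (cst 0%E).
  apply: filterS Pi0 => z Pi0 _ /=; congr EFin.
  by rewrite /g big1// => i _; rewrite big1// => j _; rewrite (Pi0 (i, j)) mul0r.
have I0 := (ae_eq_integral_abs gamma measurableT mgX).2 g0.
rewrite (lebint_density rhoP mg); last by apply/integrableP; split=> //; rewrite I0.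
by rewrite (ae_eq_integral _ _ _ _ _ g0)//; exact: integral0.
Qed.

Variables (T : V -> V) (K : set V).
Hypothesis cT : continuous T.
Hypothesis cK : closed K.
Hypothesis KP : P0 (~` K) = 0%E.
Hypothesis monoT : forall x y, K x -> K y -> 0 <= dotv (T x - T y) (x - y).
Hypothesis gammaT : forall B : set (V * V)%type, measurable B ->
  pushforward P0 (fun x => (x, T x)) B = gamma B.

Let S x := Xt t (x, T x).

Let continuous_S : continuous S.
Proof.
move=> x; rewrite /S /Xt /=.
apply: (@cvgD _ V _ (nbhs x) _ (fun x0 => (1 - t) *: x0) (fun x0 => t *: T x0)).
  by apply: cvgZ; [exact: cvg_cst|exact: cvg_id].
by apply: cvgZ; [exact: cvg_cst|exact: cT].
Qed.

(** Pairing [S x - S y = 0] with [x - y] gives [(1 - t) |x - y|^2 + t <T x - T y, x - y> = 0]. Both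
    terms are nonnegative and [1 - t > 0], so [x = y]. *)
Let injective_S : {in K &, injective S}.
Proof.
move=> x y /set_mem Kx /set_mem Ky; rewrite /S /Xt /= => Sxy.
have := monoT Kx Ky.
have E i : (1 - t) * (x - y) ord0 i + t * (T x - T y) ord0 i = 0.
  have /rowP/(_ i) := Sxy; rewrite !mxE => h; lra.
have : (1 - t) * sqnorm (x - y) + t * dotv (T x - T y) (x - y) = 0.
  rewrite /sqnorm /dotv !mulr_sumr -big_split big1// => i _ /=.
  by rewrite !mulrA -mulrDl E mul0r.
have := sqnorm_ge0 (x - y); move: t01 => /andP[t0 t1] s0 h m0.
have {s0}s0 : sqnorm (x - y) = 0 by nra.
apply/rowP => i; have := sqr_coord_le (x - y) i; rewrite s0.
have := sqr_ge0 ((x - y) ord0 i) => h1 h2.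
have /eqP : (x - y) ord0 i ^+ 2 = 0 by apply/eqP; rewrite eq_le h1 h2.
by rewrite expf_eq0 /= !mxE subr_eq0 => /eqP.
Qed.

Let mT : measurable_fun setT T. Proof. exact: continuous_measurable_rV. Qed.

Lemma ae_graph : {ae gamma, forall z, K z.1 /\ z.2 = T z.1}.
Proof.
pose G := [set z : V * V | K z.1 /\ z.2 = T z.1].
have mG : measurable G.
  have -> : G = (fst @^-1` K) `&` \bigcap_(i : 'I_d)
     (setT `&` [set z : V * V | (z.2 ord0 i)%:E = ((T z.1) ord0 i)%:E]).
    apply/seteqP; split=> [z [Kz zT]|z [Kz zT]]; split=> //.
      by move=> i _ /=; rewrite zT.
    by apply/rowP => i; have [_ []] := zT i I.
  apply: measurableI.
    rewrite -[X in measurable X]setTI; apply: measurable_fst => //.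
    exact: measurable_closed_mx.
  apply: fin_bigcap_measurable => // i _.
  apply: measurable_eqe => //; apply/measurable_EFinP.
  - exact: (measurableT_comp (measurable_mx_coord ord0 i) measurable_snd).
  - exact: (measurableT_comp (measurable_mx_coord ord0 i)
      (measurableT_comp mT measurable_fst)).
exists (~` G); split=> //; first exact: measurableC.
rewrite -gammaT; last exact: measurableC.
rewrite -[RHS]KP /pushforward; congr (P0 _).
apply/seteqP; split=> x /= h k; apply: h; first by split.
by case: k.
Qed.

(** Read along the graph of [T], the event [E] becomes a set [B] of starting points, and [S] sends
    [B] intersected with [K] to a Borel set. Injectivity on [K] shows that no other starting point
    of [K] reaches this image. *)
Lemma saturated_Xt (E : set (V * V)%type) : measurable E ->
  exists2 A : set V, measurable A & {ae gamma, forall z, E z <-> A (Xt t z)}.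
Proof.
move=> mE; pose B := [set x | E (x, T x)].
have mB : measurable B.
  have mp : measurable_fun setT (fun x : V => (x, T x)) by exact: measurable_fun_pair.
  by rewrite -[B]setTI; exact: mp.
exists (S @` (B `&` K)).
  exact: measurable_injective_image continuous_S cK injective_S _ mB.
apply: filterS ae_graph => -[x y] /= [Kx ->]; split=> [Ex|].
  by exists x.
by move=> [x' [Bx' Kx']] /injective_S <-//; exact: mem_set.
Qed.

(** Velocity and products of its components coincide almost surely with their conditional
    expectations, so the two terms of [Pi] cancel. *)
Lemma div_rhoPi_zero_monotone_map : div_rhoPi_zero rho (Pi Ct vt).
Proof.
case: vP => mv vE; case: CP => mC CE.
apply: div_rhoPi_zero_ae.
have v_ae : {ae gamma, forall z, forall i : 'I_d, Xdot z ord0 i = vt (Xt t z) ord0 i}.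
  apply: filter_forall => i; have [iv vA] := vE i.
  apply: (cond_expectation_ae_eq (measurable_Xt t) (integrable_Xdot fin2 i) iv vA).
  exact: saturated_Xt.
have C_ae : {ae gamma, forall z, forall ij : 'I_d * 'I_d,
    Xdot z ord0 ij.1 * Xdot z ord0 ij.2 = Ct (Xt t z) ij.1 ij.2}.
  apply: filter_forall => -[i j]; have [iC CA] := CE i j.
  apply: (cond_expectation_ae_eq (measurable_Xt t) (integrable_XdotM fin2 i j) iC CA).
  exact: saturated_Xt.
apply: filterS2 v_ae C_ae => z vz Cz [i j] /=.
by rewrite /Pi /outer !mxE -(Cz (i, j)) -!vz subrr.
Qed.

End Determined.

(** * Monotone maps *)

Lemma continuous_sum {R : realType} (U : topologicalType) n (F : 'I_n -> U -> R) :
  (forall i, continuous (F i)) -> continuous (fun x => \sum_(i < n) F i x).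
Proof.
by move=> cF; apply: (@continuous_big R _ +%R) => //; exact: add_continuous.
Qed.

Lemma continuous_dotv {R : realType} (U : topologicalType) d (f g : U -> 'rV[R]_d) :
  continuous f -> continuous g -> continuous (fun x => dotv (f x) (g x)).
Proof.
move=> cf cg; apply: continuous_sum => i x.
by apply: cvgM; exact: continuous_coord.
Qed.

Lemma measurable_dotv {R : realType} disp (S : measurableType disp) d
    (f g : S -> 'rV[R]_d) :
  measurable_fun setT f -> measurable_fun setT g ->
  measurable_fun setT (fun x => dotv (f x) (g x)).
Proof.
move=> mf mg; apply: measurable_sum => i; apply: measurable_funM.
- exact: (measurableT_comp (measurable_mx_coord ord0 i) mf).
- exact: (measurableT_comp (measurable_mx_coord ord0 i) mg).
Qed.

(** The difference quotient along the line is literally that of [f] in direction [h], so directional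
    derivability is enough. *)
Lemma is_derive_line {R : realType} (V W : normedModType R) (f : V -> W) (p h : V) (s : R) :
  derivable f (s *: h + p) h ->
  is_derive s 1 (fun s : R => f (s *: h + p)) ('D_h f (s *: h + p)).
Proof.
move=> df.
have E : (fun e : R => e^-1 *: (((fun s : R => f (s *: h + p)) \o shift s) (e *: 1) -
    f (s *: h + p))) =
  (fun e : R => e^-1 *: ((f \o shift (s *: h + p)) (e *: h) - f (s *: h + p))).
  apply/funext => e /=; congr (_ *: (f _ - _)).
  by rewrite scalerDl addrA [e *: 1]mulr1.
by apply: DeriveDef; rewrite /derivable /derive E.
Qed.

Section MonotonePSD.
Context {R : realType} {d : nat}.
Local Notation V := 'rV[R]_d.

(** The function [g s = <T (y + s h), h>] has derivative [<h, dT h> >= 0]; the mean value theorem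
    between 0 and 1 gives the sign of [g 1 - g 0]. *)
Lemma jacobian_psd_monotone (T : V -> V) :
  (forall x, jacobian_psd T x) ->
  forall x y, 0 <= dotv (T x - T y) (x - y).
Proof.
move=> psd x y; set h := x - y.
pose g (s : R) := \sum_(i < d) T (s *: h + y) ord0 i * h ord0 i.
have dg (s : R) : is_derive s (1 : R) g (dotv h ('d T (s *: h + y) h)).
  have [dT _] := psd (s *: h + y).
  have dTh : derivable T (s *: h + y) h by exact: diff_derivable.
  have -> : g = \sum_(i < d) (fun s => T (s *: h + y) ord0 i * h ord0 i).
    by apply/funext => r; rewrite fct_sumE.
  rewrite /dotv; apply: is_derive_sum => i.
  have di : is_derive s (1 : R) (fun s : R => T (s *: h + y) ord0 i)
      ('D_h (fun x => T x ord0 i) (s *: h + y)).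
    by apply: (@is_derive_line R V R (fun x => T x ord0 i)); exact: (derivable_mxP _ _ _).1.
  have -> : h ord0 i * ('d T (s *: h + y) h) ord0 i =
      T (s *: h + y) ord0 i *: (0 : R) +
      h ord0 i *: ('D_h (fun x => T x ord0 i) (s *: h + y)).
    by rewrite scaler0 add0r -deriveE// derive_mx// [X in _ * X = _]mxE.
  exact: (@is_deriveM R R _ (cst (h ord0 i))).
have cg : {within `[0, 1], continuous g}.
  by apply: derivable_within_continuous => s _; case: (dg s).
have [c _] := MVT ltr01 (fun s _ => dg s) cg.
rewrite subr0 mulr1 => E; have [_ /(_ h) p] := psd (c *: h + y).
move: p; rewrite -E; congr (0 <= _).
rewrite /g /dotv scale1r scale0r add0r subrK -sumrB.
by apply: eq_bigr => i _; rewrite -mulrBl !mxE.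
Qed.

End MonotonePSD.

(** * Optimal maps are monotone *)

Section SquareMeasure.
Context {R : realType} {disp : measure_display} {S : measurableType disp}.
Variable P : probability S R.
Local Notation PP := (P \x P)%E.

(** Tonelli's theorem in the two orders of integration. *)
Lemma integral_square_swap (f : S * S -> \bar R) :
  measurable_fun setT f -> (forall p, 0 <= f p)%E ->
  (\int[PP]_p f (p.2, p.1) = \int[PP]_p f p)%E.
Proof.
move=> mf f0; rewrite [RHS](fubini_tonelli1 f mf f0).
rewrite (fubini_tonelli2 (fun p => f (p.2, p.1)))//.
exact: (measurableT_comp mf (measurable_fun_pair measurable_snd measurable_fst)).
Qed.

Lemma integral_square_fst (f : S -> \bar R) :
  measurable_fun setT f -> (forall p, 0 <= f p)%E ->
  (\int[PP]_p f p.1 = \int[P]_x f x)%E.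
Proof.
move=> mf f0; rewrite (fubini_tonelli1 (fun p => f p.1))//; last first.
  exact: (measurableT_comp mf measurable_fst).
apply: eq_integral => x _; rewrite /fubini_F /= integral_cst//.
transitivity (f x * 1)%E; last exact: mule1.
by congr (_ * _)%E; exact: probability_setT.
Qed.

End SquareMeasure.

Lemma measurable_subV {R : realType} {d : nat} disp (S : measurableType disp)
    (f g : S -> 'rV[R]_d) :
  measurable_fun setT f -> measurable_fun setT g -> measurable_fun setT (fun x => f x - g x).
Proof.
move=> mf mg; apply: measurable_fun_rV => i; under eq_fun do rewrite !mxE.
apply: measurable_funB.
- exact: (measurableT_comp (measurable_mx_coord ord0 i) mf).
- exact: (measurableT_comp (measurable_mx_coord ord0 i) mg).
Qed.

Section MonotonicityForm.
Context {R : realType} {d : nat}.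
Local Notation V := 'rV[R]_d.
Variable T : V -> V.
Hypothesis mT : measurable_fun setT T.

Lemma measurable_monotonicity_form :
  measurable_fun setT (fun p : V * V => dotv (T p.1 - T p.2) (p.1 - p.2)).
Proof.
apply: measurable_dotv; apply: measurable_subV => //.
- exact: measurableT_comp mT measurable_fst.
- exact: measurableT_comp mT measurable_snd.
Qed.

Lemma measurable_nonmonotone :
  measurable [set p : V * V | dotv (T p.1 - T p.2) (p.1 - p.2) < 0].
Proof.
rewrite -[X in measurable X]setTI
  (_ : mkset _ = [set p : V * V | ((dotv (T p.1 - T p.2) (p.1 - p.2))%:E < 0%:E)%E]).
  apply: measurable_lte => //; apply/measurable_EFinP.
  exact: measurable_monotonicity_form.
by apply/seteqP; split=> p; rewrite /= lte_fin.
Qed.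

End MonotonicityForm.

(** * Exchange of images along an optimal map *)

Section OptimalMonotone.
Context {R : realType} {d : nat}.
Local Notation V := 'rV[R]_d.
Variables (P0 P1 : probability V R) (T : V -> V).
Hypothesis OT : is_OT_map P0 P1 T.
Hypothesis finite_cost : (\int[P0]_x (sqnorm (x - T x))%:E < +oo)%E.
Local Notation PP := (P0 \x P0)%E.

Let mT : measurable_fun setT T. Proof. by case: OT. Qed.

Let q (p : V * V) : R := dotv (T p.1 - T p.2) (p.1 - p.2).

Let E : set (V * V)%type := [set p | q p < 0].

(* Exchange the two points of a pair exactly when this decreases the cost. *)
Let sigma1 (p : V * V) : V := if q p < 0 then p.2 else p.1.

Let mq : measurable_fun setT q. Proof. exact: measurable_monotonicity_form. Qed.

Let qC p : q (p.2, p.1) = q p.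
Proof.
by rewrite /q /dotv /=; apply: eq_bigr => i _; rewrite !mxE; ring.
Qed.

Let msigma1 : measurable_fun setT sigma1.
Proof.
apply: measurable_fun_ifT => //.
by apply: measurable_fun_ltr => //; exact: measurable_cst.
Qed.

Let mE : measurable E. Proof. exact: measurable_nonmonotone. Qed.

(** The set [E] is symmetric because [q] is, so swapping the coordinates preserves the product law
    restricted to [E]. Exchanging on [E] therefore leaves the law [P0] of the selected point
    unchanged. *)
Let integral_sigma1 (f : V -> \bar R) :
  measurable_fun setT f -> (forall x, 0 <= f x)%E ->
  (\int[PP]_p f (sigma1 p) = \int[P0]_x f x)%E.
Proof.
move=> mf f0; rewrite -integral_square_fst//.
have mi (A : set (V * V)) : measurable A -> measurable_fun setT (fun p => (\1_A p)%:E : \bar R).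
  by move=> mA; apply/measurable_EFinP; exact: measurable_indic.
have m1 : measurable_fun setT (fun p : V * V => f p.1).
  exact: measurableT_comp mf measurable_fst.
have m2 : measurable_fun setT (fun p : V * V => f p.2).
  exact: measurableT_comp mf measurable_snd.
have mEC : measurable (~` E) by exact: measurableC.
pose a p := ((\1_E p)%:E * f p.1)%E.
pose b p := ((\1_E p)%:E * f p.2)%E.
pose c p := ((\1_(~` E) p)%:E * f p.1)%E.
have ma : measurable_fun setT a by apply: emeasurable_funM => //; exact: mi.
have mb : measurable_fun setT b by apply: emeasurable_funM => //; exact: mi.
have mc : measurable_fun setT c by apply: emeasurable_funM => //; exact: mi.
have a0 p : (0 <= a p)%E by rewrite mule_ge0// lee_fin.
have b0 p : (0 <= b p)%E by rewrite mule_ge0// lee_fin.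
have c0 p : (0 <= c p)%E by rewrite mule_ge0// lee_fin.
transitivity (\int[PP]_p (b p + c p))%E.
  apply: eq_integral => p _; rewrite /sigma1 /b /c !indicE.
  case: ifPn => qp.
    rewrite mem_set// memNset ?mul1e ?mul0e ?adde0//; exact.
  rewrite memNset ?mem_set ?mul1e ?mul0e ?add0e//; exact/negP.
rewrite ge0_integralD// -(integral_square_swap _ mb b0).
have -> : (\int[PP]_p b (p.2, p.1) = \int[PP]_p a p)%E.
  apply: eq_integral => p _; rewrite /a /b !indicE /=.
  have -> : (((p.2, p.1) : V * V) \in E) = (p \in E); last by [].
  by apply/idP/idP => /set_mem; rewrite /E /= ?qC => h; apply/mem_set; rewrite /= ?qC.
rewrite -ge0_integralD//; apply: eq_integral => p _; rewrite /a /c !indicE.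
have [pE|pE] := boolP (p \in E).
  by rewrite memNset ?mul1e ?mul0e ?adde0//; apply; exact: set_mem pE.
by rewrite mem_set ?mul1e ?mul0e ?add0e// => Ep; case/negP: pE; exact: mem_set.
Qed.

Let cost p : \bar R := (sqnorm (p.1 - T p.2))%:E.

Let mcost disp (S : measurableType disp) (f g : S -> V) :
  measurable_fun setT f -> measurable_fun setT g ->
  measurable_fun setT (fun x => cost (f x, g x)).
Proof.
move=> mf mg; apply/measurable_EFinP; apply: (measurableT_comp measurable_sqnorm).
by apply: measurable_subV => //; exact: measurableT_comp mT mg.
Qed.

Let cost0 p : (0 <= cost p)%E. Proof. by rewrite lee_fin sqnorm_ge0. Qed.

(** The competing coupling is the law of [(p.1, T (sigma1 p))] under the product law. Its second
    marginal is [P1], since [sigma1] has law [P0] and [T] sends [P0] to [P1]. *)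
Let competitor : (\int[P0]_x cost (x, x) <= \int[PP]_p cost (p.1, sigma1 p))%E.
Proof.
case: OT => _ [TP1 opt].
pose Phi (p : V * V) : V * V := (p.1, T (sigma1 p)).
have mPhi : measurable_fun setT Phi.
  apply: measurable_fun_pair => //; exact: measurableT_comp mT msigma1.
pose mixPhi := isMeasurableFun.Build _ _ _ _ _ mPhi.
pose packPhi : {mfun (V * V)%type >-> (V * V)%type} := HB.pack Phi mixPhi.
pose pi : probability (V * V)%type R := distribution (P0 \x P0)%E packPhi.
have piP : is_coupling P0 P1 pi.
  split=> A mA.
  - transitivity (PP (A `*` setT)).
      by congr (PP _); apply/seteqP; split=> [p pA|p [pA _]].
    rewrite product_measure1E//.
    transitivity (P0 A * 1)%E; last exact: mule1.
    by congr (_ * _)%E; exact: probability_setT.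
  - have mTA : measurable (T @^-1` A) by rewrite -[X in measurable X]setTI; exact: mT.
    have mS : measurable (sigma1 @^-1` (T @^-1` A)).
      by rewrite -[X in measurable X]setTI; exact: msigma1.
    transitivity (\int[PP]_p (\1_(sigma1 @^-1` (T @^-1` A)) p)%:E)%E.
      by rewrite integral_indic// setIT.
    transitivity (\int[PP]_p (EFin \o \1_(T @^-1` A)) (sigma1 p))%E; first by [].
    rewrite (integral_sigma1 (f := EFin \o \1_(T @^-1` A))).
    + by rewrite integral_indic// setIT; exact: TP1.
    + by apply/measurable_EFinP; exact: measurable_indic.
    + by move=> x /=; rewrite lee_fin.
have := opt pi piP.
rewrite [X in (_ <= X)%E -> _]ge0_integral_distribution//; last first.
- by move=> p; rewrite lee_fin sqnorm_ge0.
- apply/measurable_EFinP; apply: (measurableT_comp measurable_sqnorm).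
  exact: measurable_subV measurable_fst measurable_snd.
Qed.

Lemma OT_map_pairwise_monotone :
  PP [set p : V * V | dotv (T p.1 - T p.2) (p.1 - p.2) < 0] = 0%E.
Proof.
pose A (p : V * V) := cost (p.1, p.1); pose A' (p : V * V) := cost (p.2, p.2).
(* [B] and [B'] are the costs at the two points after the exchange; [B'] is [B] at the swapped pair,
   hence has the same integral. *)
pose B (p : V * V) := cost (p.1, sigma1 p); pose B' (p : V * V) := cost (p.2, sigma1 (p.2, p.1)).
pose G (p : V * V) : \bar R := (2 * Num.max (- q p) 0)%:E.
have mA : measurable_fun setT A by apply: mcost; exact: measurable_fst.
have mA' : measurable_fun setT A' by apply: mcost; exact: measurable_snd.
have mB : measurable_fun setT B by apply: mcost => //; exact: measurable_fst.
have mswap : measurable_fun setT (fun p : V * V => (p.2, p.1)).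
  exact: measurable_fun_pair measurable_snd measurable_fst.
have mB' : measurable_fun setT B' by exact: (measurableT_comp mB mswap).
have mG : measurable_fun setT G.
  apply/measurable_EFinP; apply: measurable_funM => //.
  by apply: measurable_maxr => //; exact: measurable_funN.
have G0 p : (0 <= G p)%E by rewrite lee_fin mulr_ge0// le_max lexx orbT.
have A0 p : (0 <= A p)%E by exact: cost0.
have A0' p : (0 <= A' p)%E by exact: cost0.
have B0 p : (0 <= B p)%E by exact: cost0.
have B0' p : (0 <= B' p)%E by exact: cost0.
(* With [p = (x, y)], [|x - T x|^2 + |y - T y|^2 - |x - T y|^2 - |y - T x|^2 = - 2 q p]; so [G] is
   the saving obtained from the exchange. *)
have AB p : (A p + A' p = (B p + B' p) + G p)%E.
  rewrite /A /A' /B /B' /G /cost /sigma1 qC /= -!EFinD; congr EFin.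
  case: ltP => qp.
    rewrite max_l ?oppr_ge0 ?ltW//.
    rewrite /q /sqnorm /dotv /= -sumrN mulr_sumr -!big_split/=.
    by apply: eq_bigr => i _; rewrite !mxE; ring.
  by rewrite max_r ?oppr_le0// mulr0 addr0.
have iA : (\int[PP]_p A p = \int[P0]_x cost (x, x))%E.
  apply: (integral_square_fst P0 (f := fun x => cost (x, x))) => //.
  by apply: mcost.
have iA' : (\int[PP]_p A' p = \int[P0]_x cost (x, x))%E.
  by rewrite -iA -(integral_square_swap P0 mA A0).
have iB' : (\int[PP]_p B' p = \int[PP]_p B p)%E.
  by rewrite -(integral_square_swap P0 mB B0).
have sumI : (\int[P0]_x cost (x, x) + \int[P0]_x cost (x, x) =
    (\int[PP]_p B p + \int[PP]_p B p) + \int[PP]_p G p)%E.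
  transitivity (\int[PP]_p (A p + A' p))%E; first by rewrite ge0_integralD// iA iA'.
  transitivity (\int[PP]_p ((B p + B' p) + G p))%E; first exact: eq_integral.
  have BB0 p : (0 <= B p + B' p)%E by rewrite adde_ge0.
  have mBB : measurable_fun setT (fun p => B p + B' p)%E by exact: emeasurable_funD.
  rewrite (@ge0_integralD _ _ _ PP _ measurableT (fun p => B p + B' p)%E G)//.
  by rewrite ge0_integralD// iB'.
(* With [a] the optimal cost, [b] that of the competitor and [c] the integral of [G]:
   [2 a = 2 b + c], [a <= b] and [a] finite force [c = 0]. *)
have G1 : (\int[PP]_p G p = 0)%E.
  have := competitor; have := sumI.
  have G2 : (0 <= \int[PP]_p G p)%E by exact: integral_ge0.
  have : (0 <= \int[PP]_p B p)%E by exact: integral_ge0.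
  have : (0 <= \int[P0]_x cost (x, x))%E by exact: integral_ge0.
  move: finite_cost G2; rewrite /cost /=.
  move: (\int[P0]_x _)%E (\int[PP]_p B p)%E (\int[PP]_p G p)%E.
  move=> [a| |] [b| |] [c| |]//= _; rewrite ?lee_fin -?EFinD => c0 a0 b0 //.
  by move=> [abc] ab; congr EFin; lra.
have : ae_eq PP setT G (cst 0%E).
  apply/ae_eq_integral_abs => //.
  by under eq_integral do rewrite gee0_abs//.
move=> Gae; apply: measure_negligible => //.
apply: negligibleS Gae => p /= qp /(_ I) [] /eqP.
rewrite mulf_eq0 pnatr_eq0 /= max_l ?oppr_ge0 ?ltW// oppr_eq0 => /eqP q0.
by move: qp; rewrite -/(q p) q0 ltxx.
Qed.

End OptimalMonotone.

(** * The support of a probability *)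

Section Support.
Context {R : realType} {d : nat}.
Local Notation V := 'rV[R]_d.
Variable P : probability V R.

(** The topological support, tested on rational boxes only, so that its complement is a countable
    union of null boxes. *)
Definition support : set V :=
  [set x | forall p, rat_box p x -> P (rat_box p) != 0%E].

Lemma setC_support : ~` support =
  \bigcup_(p in [set p | P (@rat_box R d p) = 0%E]) rat_box p.
Proof.
apply/seteqP; split=> [x /existsNP[p /not_implyP[px /negP]]|x [p /= p0 px] xs].
  by rewrite negbK => /eqP p0; exists p.
by have := xs p px; rewrite p0 eqxx.
Qed.

Lemma closed_support : closed support.
Proof.
rewrite -openC setC_support; apply: bigcup_open => p _; exact: rat_box_open.
Qed.

Lemma support_full : P (~` support) = 0%E.
Proof.
(* Enumeration of the null boxes by their codes; every other index contributes the empty set. *)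
pose B n : set V := if unpickle n is Some p then
  if P (rat_box p) == 0%E then rat_box p else set0 else set0.
apply: measure_negligible.
  by apply: measurableC; apply: measurable_closed_mx; exact: closed_support.
apply: (@negligibleS _ _ _ _ (\bigcup_n B n)).
  rewrite setC_support => x [p /= p0 px]; exists (pickle p) => //.
  by rewrite /B pickleK p0 eqxx.
apply: negligible_bigcup => n; rewrite /B; case: (unpickle n) => [p|].
  case: ifPn => [/eqP p0|_]; last exact: negligible_set0.
  apply/negligibleP => //; apply: measurable_open_mx; exact: rat_box_open.
exact: negligible_set0.
Qed.

(** A strictly negative value at [(x, y)] persists on a product of two boxes around [x] and [y].
    Each box has positive mass when the points lie in the support, so the product would not be
    negligible. *)
Lemma pairwise_monotone_support (T : V -> V) : continuous T ->
  (P \x P)%E [set p : V * V | dotv (T p.1 - T p.2) (p.1 - p.2) < 0] = 0%E ->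
  forall x y, support x -> support y -> 0 <= dotv (T x - T y) (x - y).
Proof.
move=> cT PP0 x y xs ys; rewrite leNgt; apply/negP => xy.
pose E := [set p : V * V | dotv (T p.1 - T p.2) (p.1 - p.2) < 0].
have cq : continuous (fun p : V * V => dotv (T p.1 - T p.2) (p.1 - p.2)).
  apply: continuous_dotv => p; apply: cvgB.
  - by apply: (cvg_comp _ _ cvg_fst); exact: cT.
  - by apply: (cvg_comp _ _ cvg_snd); exact: cT.
  - exact: cvg_fst.
  - exact: cvg_snd.
have oE : open E.
  have -> : E = (fun p : V * V => dotv (T p.1 - T p.2) (p.1 - p.2)) @^-1` [set r | r < 0] by [].
  by apply: open_comp; [move=> p _; exact: cq|exact: open_lt].
have [[U W] /= [Ux Wy] UW] : nbhs (x, y) E by apply: open_nbhs_nbhs; split.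
have [p [px pU]] := rat_box_basis Ux.
have [r [ry rW]] := rat_box_basis Wy.
have mb (s : 'rV[rat]_d * 'rV[rat]_d) : measurable (@rat_box R d s).
  by apply: measurable_open_mx; exact: rat_box_open.
have : (P (rat_box p) * P (rat_box r) <= 0)%E.
  rewrite -PP0 -product_measure1E//; apply: le_measure; rewrite ?inE.
  - exact: measurableX.
  - by apply: measurable_nonmonotone; exact: continuous_measurable_rV.
  - by move=> z [zp zr]; apply: UW; split; [exact: pU|exact: rW].
have := xs p px; have := ys r ry.
by rewrite -!measure_gt0 => r0 p0; rewrite leNgt mule_gt0.
Qed.

End Support.

(** * Test fields *)

Section FlatExponential.
Context {R : realType}.
Implicit Types (k : nat) (s : R).

(** For [k = 0] this is the classical flat function [exp (- 1 / s)] extended by 0. The powers of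
    [1 / s] are included because differentiation produces them. *)
Definition flat_exp k s : R := if 0 < s then s^-1 ^+ k * expR (- s^-1) else 0.

Lemma flat_exp_ge0 k s : 0 <= flat_exp k s.
Proof.
rewrite /flat_exp; case: ifP => // s0.
by rewrite mulr_ge0 ?expR_ge0// exprn_ge0// invr_ge0 ltW.
Qed.

Lemma flat_exp_le0 k s : s <= 0 -> flat_exp k s = 0.
Proof. by move=> s0; rewrite /flat_exp ltNge s0. Qed.

(** One term of the exponential series is at most its sum. *)
Lemma expRn_le k (x : R) : 0 <= x -> x ^+ k * expR (- x) <= k`!%:R.
Proof.
move=> x0; rewrite expRN ler_pdivrMr ?expR_gt0//; case: k => [|k].
  by rewrite expr0 fact0 mul1r -expR0 ler_expR.
have := expR_ge1Dxn k x0; rewrite -lerBrDl => h.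
rewrite -ler_pdivrMl ?ltr0n ?fact_gt0// mulrC (le_trans h)//.
by rewrite lerBlDl lerDr.
Qed.

(** For [s > 0], write [s^-k] as [s^m s^-(k + m)] and bound the last power times the exponential by
    a factorial. The case [m = 0] gives boundedness, the case [m = 2] the derivative at 0. *)
Lemma flat_exp_bound k m s : flat_exp k s <= (k + m)`!%:R * `|s| ^+ m.
Proof.
have [s0|s0] := leP s 0; first by rewrite flat_exp_le0// mulr_ge0// exprn_ge0.
rewrite /flat_exp s0 gtr0_norm// -ler_pdivrMr ?exprn_gt0//.
have s1 : 0 <= s^-1 by rewrite invr_ge0 ltW.
by have := expRn_le (k + m) s1; rewrite exprD [s^-1 ^+ m]exprVn mulrAC.
Qed.

Lemma is_derive_flat_exp k s :
  is_derive s 1 (flat_exp k) (flat_exp k.+2 s - k%:R * flat_exp k.+1 s).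
Proof.
have [s0|s0|s0] := ltgtP s 0.
- rewrite !flat_exp_le0 ?(ltW s0)// mulr0 subr0.
  apply: (@near_eq_is_derive _ _ _ (cst 0)).
  near=> y; rewrite /= flat_exp_le0//; apply: ltW; near: y; exact: lt_nbhsl.
- apply: (@near_eq_is_derive R R R (fun y : R => y^-1 ^+ k * expR (- y^-1))).
    near=> y; rewrite /flat_exp ifT//; near: y; exact: lt_nbhsr.
  have dV : is_derive s (1 : R) (fun y : R => y^-1) (- s ^- 2).
    have sn : (@id R) s != 0 by rewrite gt_eqF.
    have d1 := @derivableV R R id s (1 : R) sn (@derivable_id R R s 1).
    apply: DeriveDef; first exact: d1.
    by rewrite (@deriveV R R id s 1 sn (@derivable_id R R s 1)) derive_id [_ *: _]mulr1.
  have dE : is_derive s (1 : R) (fun y : R => expR (- y^-1)) (expR (- s^-1) * s ^- 2).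
    have dN : is_derive s (1 : R) (fun y : R => - y^-1) (s ^- 2).
      by have := is_deriveN dV; rewrite opprK.
    exact: (@is_derive1_comp R expR (fun y => - y^-1) s _ _ _ dN).
  have dX := is_deriveX k dV.
  have dM := is_deriveM dX dE; rewrite mulrfctE exprfctE in dM.
  apply: (is_derive_eq dM); rewrite /flat_exp s0 /GRing.scale /=.
  rewrite -!exprVn !exprS; set a := s^-1; set E := expR (- a).
  move: a E => a E.
  case: k {dX dM} => [|k]; rewrite ?expr0 /= ?exprS; ring.
(* At the junction point the function is quadratically small, so the difference quotient is at most
   [(k + 2)! |h|]. *)
- rewrite s0 !flat_exp_le0// mulr0 subr0.
  have h0 e : `|flat_exp k e| <= (k + 2)`!%:R * `|e| ^+ 2.
    by rewrite ger0_norm ?flat_exp_ge0// flat_exp_bound.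
  have lim0 : (fun h : R => h^-1 *: ((flat_exp k \o shift 0) (h *: 1) - flat_exp k 0))
      @ 0^' --> (0 : R).
    apply/cvgr0Pnorm_le => e e0; near=> h.
    rewrite /= addr0 [h *: 1]mulr1 (@flat_exp_le0 k 0)// subr0 [h^-1 *: _]/(_ * _) normrM normfV.
    have hn : 0 < `|h| by rewrite normr_gt0; near: h; exact: nbhs_dnbhs_neq.
    rewrite mulrC ler_pdivrMr// (le_trans (h0 h))// expr2 mulrA ler_wpM2r//.
    rewrite -ler_pdivlMl ?ltr0n ?fact_gt0//.
    near: h; apply: dnbhs0_le; rewrite mulr_gt0// invr_gt0 ltr0n fact_gt0.
  apply: DeriveDef; first by apply/cvg_ex; exists 0.
  exact: cvg_lim lim0.
Unshelve. all: by end_near.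
Qed.

End FlatExponential.

(** * A class of smooth functions closed under differentiation *)

Section SmoothFunctions.
Context {R : realType} {d : nat}.
Local Notation V := 'rV[R]_d.

(** The generators are chosen so that directional derivatives stay in the class; as its members are
    continuous, smoothness to all orders follows by induction on the list of directions. *)
Inductive smooth_expr : (V -> R) -> Prop :=
| smooth_cst c : smooth_expr (fun=> c)
| smooth_coord i : smooth_expr (fun x => x ord0 i)
| smooth_add f g : smooth_expr f -> smooth_expr g -> smooth_expr (fun x => f x + g x)
| smooth_mul f g : smooth_expr f -> smooth_expr g -> smooth_expr (fun x => f x * g x)
| smooth_flat_exp k f : smooth_expr f -> smooth_expr (fun x => flat_exp k (f x)).

Lemma is_derive_coord (x v : V) i : is_derive x v (fun x : V => x ord0 i) (v ord0 i).
Proof.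
have d_id : derivable (@id V) x v by exact: derivable_id.
apply: DeriveDef; first by have := (derivable_mxP _ _ _).1 d_id; apply.
by have := derive_mx d_id; rewrite derive_id => /rowP/(_ i); rewrite mxE => <-.
Qed.

(** Restriction to the line through [x] in direction [v] reduces this to the chain rule in one
    variable. *)
Lemma is_derive_comp1 (h : R -> R) (f : V -> R) (x v : V) (a b : R) :
  is_derive (f x) 1 h a -> is_derive x v f b ->
  is_derive x v (fun x => h (f x)) (a * b).
Proof.
move=> dh [df fb].
have df0 : derivable f (0 *: v + x) v by rewrite scale0r add0r.
have := is_derive_line df0; rewrite scale0r add0r fb => dl.
have dh0 : is_derive (f ((0 : R) *: v + x)) 1 h a by rewrite scale0r add0r.
have [dc cE] := @is_derive1_comp R h (fun s : R => f (s *: v + x)) 0 _ _ dh0 dl.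
have dhf : derivable (fun x => h (f x)) x v by exact/derivable1P.
apply: DeriveDef => //.
have dhf0 : derivable (fun x => h (f x)) (0 *: v + x) v by rewrite scale0r add0r.
have [_] := is_derive_line dhf0; rewrite scale0r add0r => <-.
exact: cE.
Qed.

Lemma smooth_expr_derive f (v : V) : smooth_expr f ->
  exists2 g, smooth_expr g & forall x, is_derive x v f (g x).
Proof.
elim=> {f} [c|i|f g sf [f' sf' ff'] sg [g' sg' gg']
  |f g sf [f' sf' ff'] sg [g' sg' gg']|k f sf [f' sf' ff']].
- by exists (fun=> 0); [exact: smooth_cst|move=> x; exact: is_derive_cst].
- by exists (fun=> v ord0 i); [exact: smooth_cst|move=> x; exact: is_derive_coord].
- exists (fun x => f' x + g' x); first exact: smooth_add.
  by move=> x; exact: is_deriveD.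
- exists (fun x => f x * g' x + g x * f' x).
    by apply: smooth_add; apply: smooth_mul.
  by move=> x; exact: is_deriveM.
- exists (fun x => (flat_exp k.+2 (f x) + (- k%:R) * flat_exp k.+1 (f x)) * f' x).
    apply: smooth_mul => //; apply: smooth_add; first exact: smooth_flat_exp.
    by apply: smooth_mul; [exact: smooth_cst|exact: smooth_flat_exp].
  move=> x; apply: is_derive_comp1 => //; rewrite mulNr.
  exact: is_derive_flat_exp.
Qed.

Lemma continuous_flat_exp k : continuous (@flat_exp R k).
Proof.
move=> s; apply: differentiable_continuous; apply/derivable1_diffP.
by case: (is_derive_flat_exp k s).
Qed.

Lemma smooth_expr_continuous f : smooth_expr f -> continuous f.
Proof.
elim=> {f} [c|i|f g _ cf _ cg|f g _ cf _ cg|k f _ cf] x.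
- exact: cst_continuous.
- exact: coord_continuous.
- by have := cvgD (cf x) (cg x); apply.
- by have := cvgM (cf x) (cg x); apply.
- exact: (continuous_comp (cf x) (@continuous_flat_exp k (f x))).
Qed.

Lemma smooth_expr_sum n (F : 'I_n -> V -> R) :
  (forall i, smooth_expr (F i)) -> smooth_expr (fun x => \sum_(i < n) F i x).
Proof.
move=> sF; elim: (index_enum _) => [|i s IH].
  by under eq_fun do rewrite big_nil; exact: smooth_cst.
by under eq_fun do rewrite big_cons; exact: smooth_add.
Qed.

Lemma is_derive_scale_vector (f : V -> R) (w x v : V) (df : R) :
  is_derive x v f df -> is_derive x v (fun x => f x *: w) (df *: w).
Proof.
move=> dfx.
have di i j : is_derive x v (fun x => (f x *: w) i j) ((df *: w) i j).
  under eq_fun do rewrite mxE.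
  rewrite mxE mulrC -[X in is_derive _ _ _ X]add0r -(scaler0 _ (f x)).
  exact: (@is_deriveM R V f (cst (w i j)) x v _ _ dfx).
have dw : derivable (fun x => f x *: w) x v.
  by apply/derivable_mxP => i j; case: (di i j).
apply: DeriveDef => //; rewrite derive_mx//; apply/matrixP => i j; rewrite mxE.
by case: (di i j).
Qed.

(** Every iterated derivative keeps the form [g x *: w] with [g] in the class. *)
Lemma smooth_expr_scale_vector (f : V -> R) (w : V) :
  smooth_expr f -> smooth (fun x => f x *: w).
Proof.
move=> sf s.
have [g sg ->] : exists2 g, smooth_expr g & iderive s (fun x => f x *: w) = (fun x => g x *: w).
  elim: s => [|v s [g sg IH]]; first by exists f.
  have [g' sg' gg'] := smooth_expr_derive v sg.
  exists g' => //=; rewrite IH; apply/funext => x.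
  by case: (is_derive_scale_vector w (gg' x)).
split=> [x|v x].
  have cw : (fun _ : V => w) @ x --> w by have := @cst_continuous V V w x; apply.
  by have := cvgZ (@smooth_expr_continuous g sg x) cw; apply.
have [g' sg' gg'] := smooth_expr_derive v sg.
by case: (is_derive_scale_vector w (gg' x)).
Qed.

End SmoothFunctions.

(** * Truncated linear fields and uniform bounds on their derivatives *)

Section TestFields.
Context {R : realType} {d : nat}.
Local Notation V := 'rV[R]_d.

(* Truncation of the linear field [x |-> x_j e_j] to the ball of radius n.+1. *)
Definition cutoff_arg n (x : V) : R := 1 - n.+1%:R ^- 2 * sqnorm x.
Definition cutoff_coord n j (x : V) : R := x ord0 j * flat_exp 0 (cutoff_arg n x).
Definition cutoff_field n j (x : V) : V := cutoff_coord n j x *: ebasis R j.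

Lemma smooth_cutoff_arg n : smooth_expr (cutoff_arg n).
Proof.
have -> : cutoff_arg n = fun x => 1 + (- n.+1%:R ^- 2) * sqnorm x.
  by apply/funext => x; rewrite /cutoff_arg mulNr.
apply: smooth_add; first exact: smooth_cst.
apply: smooth_mul; first exact: smooth_cst.
by apply: smooth_expr_sum => i; apply: smooth_mul; exact: smooth_coord.
Qed.

Lemma smooth_cutoff_coord n j : smooth_expr (cutoff_coord n j).
Proof.
by apply: smooth_mul; [exact: smooth_coord|apply: smooth_flat_exp; exact: smooth_cutoff_arg].
Qed.

Lemma cutoff_arg_gt0 n (x : V) : 0 < cutoff_arg n x -> sqnorm x < n.+1%:R ^+ 2.
Proof.
rewrite /cutoff_arg subr_gt0 mulrC ltr_pdivrMr ?mul1r// exprn_gt0//.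
Qed.

(** The field vanishes outside a closed Euclidean ball, which is bounded for the maximum norm
    because each squared coordinate is at most [sqnorm]. *)
Lemma cutoff_field_test n j : test_function (cutoff_field n j).
Proof.
split; first exact/smooth_expr_scale_vector/smooth_cutoff_coord.
pose B := [set x : V | sqnorm x <= n.+1%:R ^+ 2].
have cB : closed B.
  have -> : B = (@sqnorm R d) @^-1` [set r : R | r <= n.+1%:R ^+ 2] by [].
  apply: closed_comp; last exact: closed_le.
  move=> x _; apply: (@continuous_dotv R V d id id) => y; exact: cvg_id.
apply: (@subclosed_compact _ _ B).
- exact: closed_closure.
- apply: bounded_closed_compact => //.
  exists n.+1%:R; split; first exact: num_real.
  move=> M nM x /= xB; apply: le_trans (ltW nM).
  rewrite [leLHS]/Num.Def.normr /= mx_normrE; apply: bigmax_le => // -[i k] _ /=.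
  rewrite (ord1 i) -(@ler_sqr R) ?nnegrE// -normrX ger0_norm ?sqr_ge0//.
  by apply: le_trans xB; exact: sqr_coord_le.
- rewrite closureE; apply: smallest_sub => // x /= /eqP phi0; rewrite /B /= leNgt.
  apply/negP => xn; apply: phi0;
  rewrite /cutoff_field /cutoff_coord flat_exp_le0 ?mulr0 ?scale0r//.
  rewrite leNgt; apply/negP => /cutoff_arg_gt0; rewrite ltNge => /negP; apply; exact: ltW.
Qed.

(** The derivative of [cutoff_coord n j] along the basis vector [i]; [flat_exp 2] appears as the
    derivative of [flat_exp 0]. *)
Definition cutoff_partial n j i (x : V) : R :=
  (i == j)%:R * flat_exp 0 (cutoff_arg n x)
  - 2 * n.+1%:R ^- 2 * (x ord0 i * x ord0 j) * flat_exp 2 (cutoff_arg n x).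

Lemma is_derive_cutoff_coord n j i (x : V) :
  is_derive x (ebasis R i) (cutoff_coord n j) (cutoff_partial n j i x).
Proof.
have dc k : is_derive x (ebasis R i) (fun x : V => x ord0 k) (i == k)%:R.
  have := is_derive_coord x (ebasis R i) k.
  by rewrite mxE eqxx /= eq_sym.
have ds : is_derive x (ebasis R i) (@sqnorm R d) (2 * x ord0 i).
  have -> : @sqnorm R d = \sum_(k < d) (fun x : V => x ord0 k * x ord0 k).
    by apply/funext => y; rewrite fct_sumE.
  have -> : 2 * x ord0 i = \sum_(k < d)
      (x ord0 k *: ((i == k)%:R : R) + x ord0 k *: ((i == k)%:R : R)).
    rewrite (bigD1 i)//= eqxx big1 ?addr0; first by rewrite /GRing.scale /=; ring.
    by move=> k /negPf ki; rewrite eq_sym ki !scaler0 addr0.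
  apply: is_derive_sum => k; exact: is_deriveM.
have da : is_derive x (ebasis R i) (cutoff_arg n) (- (n.+1%:R ^- 2 * (2 * x ord0 i))).
  have dz := @is_deriveZ R V R (@sqnorm R d) (n.+1%:R ^- 2) x _ _ ds.
  have := @is_deriveB R V R (cst 1) _ x _ _ _ (is_derive_cst _ _ _) dz.
  by rewrite sub0r.
have df := is_derive_comp1 (is_derive_flat_exp 0 (cutoff_arg n x)) da.
apply: is_derive_eq (is_deriveM (dc j) df) _.
by rewrite /cutoff_partial /GRing.scale /=; ring.
Qed.

Lemma partial_cutoff_field n j i k (x : V) :
  partial i k (cutoff_field n j) x = cutoff_partial n j i x * (k == j)%:R.
Proof.
rewrite /partial /cutoff_field.
have [_ ->] := is_derive_scale_vector (ebasis R j) (is_derive_cutoff_coord n j i x).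
by rewrite !mxE eqxx.
Qed.

(** The first term is at most 1. Where the cutoff is nonzero, [|x_i x_j| <= (n + 1)^2], and
    [flat_exp 2 <= 2!], so the second is at most [2 * 2]. Uniformity in [n] is what dominated
    convergence needs. *)
Lemma cutoff_partial_bound n j i (x : V) : `|cutoff_partial n j i x| <= 5.
Proof.
have f0 : flat_exp 0 (cutoff_arg n x) <= 1.
  by have := flat_exp_bound 0 0 (cutoff_arg n x); rewrite fact0 mul1r expr0.
have f2 : flat_exp 2 (cutoff_arg n x) <= 2.
  by have := flat_exp_bound 2 0 (cutoff_arg n x); rewrite expr0 mulr1.
rewrite /cutoff_partial (le_trans (ler_normB _ _))//.
have -> : 5 = 1 + 4 :> R by ring.
apply: lerD.
  rewrite normrM (ger0_norm (flat_exp_ge0 _ _)).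
  by case: (i == j); rewrite ?normr1 ?mul1r// normr0 mul0r.
have [a0|a0] := leP (cutoff_arg n x) 0.
  by rewrite flat_exp_le0// mulr0 normr0.
have /cutoff_arg_gt0 xn := a0.
rewrite normrM (ger0_norm (flat_exp_ge0 _ _)).
have -> : 4 = 2 * 2 :> R by ring.
apply: ler_pM => //; first exact: flat_exp_ge0.
rewrite -mulrA normrM ger0_norm// ler_piMr//.
rewrite normrM gtr0_norm ?invr_gt0 ?exprn_gt0// mulrC ler_pdivrMr ?exprn_gt0// mul1r.
apply: le_trans (ltW xn).
have := sqr_coord_le x i; have := sqr_coord_le x j.
move: (x ord0 i) (x ord0 j) (sqnorm x) => a b c h1 h2.
have := sqr_ge0 (a - b); have := sqr_ge0 (a + b).
by rewrite ler_norml => *; apply/andP; split; lra.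
Qed.

Lemma cvg_inv_sqr : (fun n : nat => n.+1%:R ^- 2 : R) @ \oo --> 0.
Proof.
have -> : (fun n : nat => n.+1%:R ^- 2 : R) = (fun n => n.+1%:R^-1 * n.+1%:R^-1).
  by apply/funext => n; rewrite -exprVn expr2.
rewrite -[X in _ --> X](mulr0 0); apply: cvgM; exact: cvg_harmonic.
Qed.

(** The argument of the cutoff tends to 1 at each fixed point, and the second term carries the
    vanishing factor [(n + 1)^-2]. The limit keeps the factor [flat_exp 0 1], that is [exp (-1)], as
    the cutoff is not normalised. *)
Lemma cvg_cutoff_partial j i (x : V) :
  (fun n => cutoff_partial n j i x) @ \oo --> (i == j)%:R * flat_exp 0 (1 : R).
Proof.
have ca : (fun n => cutoff_arg n x) @ \oo --> (1 : R).
  rewrite -[X in _ --> X](subr0 1) -[X in _ - X](mul0r (sqnorm x)).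
  apply: cvgB; first exact: cvg_cst.
  by apply: cvgM; [exact: cvg_inv_sqr|exact: cvg_cst].
have cf k : (fun n => flat_exp k (cutoff_arg n x)) @ \oo --> flat_exp k (1 : R).
  exact: (cvg_comp _ _ ca (@continuous_flat_exp R k 1)).
rewrite (_ : _ * _ = (i == j)%:R * flat_exp 0 (1 : R) -
  2 * 0 * (x ord0 i * x ord0 j) * flat_exp 2 (1 : R)); last by ring.
apply: cvgB; first by apply: cvgM; [exact: cvg_cst|exact: cf].
apply: cvgM; last exact: cf.
apply: cvgM; last exact: cvg_cst.
by apply: cvgM; [exact: cvg_cst|exact: cvg_inv_sqr].
Qed.

End TestFields.

(** * Necessity and the theorem *)

Section Necessity.
Context {R : realType} {d : nat}.
Local Notation V := 'rV[R]_d.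
Variables (gamma : probability (V * V)%type R) (t : R).
Variables (rho : V -> R) (vt : V -> V) (Ct : V -> 'M[R]_d).
Hypothesis rhoP : is_density gamma t rho.
Hypothesis vP : is_cond_velocity gamma t vt.
Hypothesis CP : is_cond_second_moment gamma t Ct.
Hypothesis fin2 : forall t, 0 <= t <= 1 ->
  (\int[gamma]_z (sqnorm (Xt t z))%:E < +oo)%E.
Hypothesis finPi : (\int[gamma]_z (sqnormM (Pi Ct vt (Xt t z)))%:E < +oo)%E.
Hypothesis div0 : div_rhoPi_zero rho (Pi Ct vt).

Let measurable_PiX i j : measurable_fun setT (fun z => Pi Ct vt (Xt t z) i j).
Proof. exact: (measurableT_comp (measurable_Pi vP CP i j) (measurable_Xt t)). Qed.

Lemma integrable_PiX i j :
  gamma.-integrable setT (EFin \o (fun z => Pi Ct vt (Xt t z) i j)).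
Proof.
have s0 z : 0 <= sqnormM (Pi Ct vt (Xt t z)).
  by apply: sumr_ge0 => k _; apply: sumr_ge0 => l _; exact: sqr_ge0.
have iS : gamma.-integrable setT (EFin \o (fun z => sqnormM (Pi Ct vt (Xt t z)))).
  apply/integrableP; split.
    apply/measurable_EFinP; apply: measurable_sum => k; apply: measurable_sum => l.
    exact: measurable_funX.
  by under eq_integral do rewrite /= ger0_norm//.
have i1 : gamma.-integrable setT (EFin \o cst (1 : R)).
  exact: finite_measure_integrable_cst.
apply: (@integrable_le _ _ _ gamma _ (fun z => 1 + sqnormM (Pi Ct vt (Xt t z)))).
- exact: measurable_PiX.
- exact: (integrableD measurableT i1 iS).
- move=> z; have : Pi Ct vt (Xt t z) i j ^+ 2 <= sqnormM (Pi Ct vt (Xt t z)).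
    rewrite /sqnormM (bigD1 i)//= (bigD1 j)//= -addrA lerDl addr_ge0//.
      by apply: sumr_ge0 => l _; exact: sqr_ge0.
    by apply: sumr_ge0 => k _; apply: sumr_ge0 => l _; exact: sqr_ge0.
  move: (Pi _ _ _ i j) (sqnormM _) => a b ab.
  by rewrite ler_norml; apply/andP; split; nra.
Qed.

Lemma integral_Pi_diag j : (\int[gamma]_z (Pi Ct vt (Xt t z) j j)%:E = 0)%E.
Proof.
pose g n x := \sum_(i < d) Pi Ct vt x i j * cutoff_partial n j i x.
pose c : R := flat_exp 0 1.
have c0 : c != 0 by rewrite /c /flat_exp ltr01 expr0 mul1r gt_eqF// expR_gt0.
have gE n x : \sum_(i < d) \sum_(k < d)
    Pi Ct vt x i k * partial i k (cutoff_field n j) x = g n x.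
  apply: eq_bigr => i _; rewrite (bigD1 j)//= big1 => [|k /negPf kj].
    by rewrite addr0 partial_cutoff_field eqxx mulr1.
  by rewrite partial_cutoff_field kj mulr0 mulr0.
have mg n : measurable_fun setT (g n).
  rewrite -(_ : (fun x => \sum_(i < d) \sum_(k < d)
      Pi Ct vt x i k * partial i k (cutoff_field n j) x) = g n); last exact/funext.
  apply: measurable_sum => i; apply: measurable_sum => k; apply: measurable_funM.
    exact: measurable_Pi vP CP i k.
  exact: (measurable_partial i k (cutoff_field_test n j).1).
have mgX n : measurable_fun setT (fun z => (g n (Xt t z))%:E).
  by apply/measurable_EFinP; exact: (measurableT_comp (mg n) (measurable_Xt t)).
(* An integrable bound on all the tested integrands, with the constant 5 of
   [cutoff_partial_bound]. *)
pose D z := \sum_(i < d) (5 * `|Pi Ct vt (Xt t z) i j|).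
have iD : gamma.-integrable setT (EFin \o D).
  have -> : EFin \o D = (fun z => \sum_(i < d) (5%:E * `|(Pi Ct vt (Xt t z) i j)%:E|))%E.
    by apply/funext => z; rewrite /D /= -sumEFin; apply: eq_bigr => i _.
  apply: integrable_sum => // i _; apply: integrableZl => //.
  exact: integrable_abse (integrable_PiX i j).
have gD n z : `|g n (Xt t z)| <= D z.
  apply: le_trans (ler_norm_sum _ _ _) _; apply: ler_sum => i _.
  by rewrite normrM mulrC ler_wpM2r// cutoff_partial_bound.
have ig n : gamma.-integrable setT (fun z => (g n (Xt t z))%:E).
  apply: (@integrable_le _ _ _ gamma _ D) => //.
  by apply/measurable_EFinP; exact: mgX.
have g0 n : (\int[gamma]_z (g n (Xt t z))%:E = 0)%E.
  rewrite -(lebint_density rhoP (mg n) (ig n)) -(div0 (cutoff_field_test n j)).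
  by congr lebint; apply/funext => x; rewrite gE.
have mlim : measurable_fun setT (fun z => (c * Pi Ct vt (Xt t z) j j)%:E).
  by apply/measurable_EFinP; apply: measurable_funM => //; exact: measurable_PiX.
have h1 : \forall z \ae gamma, setT z -> (g n (Xt t z))%:E @[n --> \oo] -->
    (c * Pi Ct vt (Xt t z) j j)%:E.
  apply: aeW => z _; apply: cvg_EFin; first exact: nearW.
  rewrite (_ : _ * _ = \sum_(i < d) Pi Ct vt (Xt t z) i j * ((i == j)%:R * c)); last first.
    rewrite (bigD1 j)//= eqxx mul1r mulrC big1 ?addr0// => i /negPf ->.
    by rewrite mul0r mulr0.
  apply: cvg_big => [|i _]; first exact: add_continuous.
  by apply: cvgM; [exact: cvg_cst|exact: cvg_cutoff_partial].
have h2 : \forall z \ae gamma, forall n, setT z -> (`|(g n (Xt t z))%:E| <= (EFin \o D) z)%E.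
  by apply: aeW => z n _; rewrite lee_fin gD.
have [_ _] := dominated_convergence measurableT mgX mlim h1 iD h2.
under eq_fun do rewrite g0.
move=> /cvg_lim => /(_ (@ereal_hausdorff _)); rewrite lim_cst//.
under eq_integral do rewrite EFinM.
rewrite integralZl//; last exact: integrable_PiX.
move=> /esym/eqP; rewrite mule_eq0 eqe (negPf c0) /= => /eqP.
by [].
Qed.

(** With [a] the velocity component and [b] its conditional expectation, [E (a b) = E b^2] by
    pulling out [b], and [E a^2 = E Pi_jj + E b^2 = E b^2]. Hence [E (a - b)^2 = 0]. *)
Lemma ae_Xdot_velocity j : {ae gamma, forall z, Xdot z ord0 j = vt (Xt t z) ord0 j}.
Proof.
have [mv vE] := vP; have [mC CE] := CP.
have [iv vA] := vE j; have [iC CA] := CE j j.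
have iX := integrable_Xdot fin2 j; have iXX := integrable_XdotM fin2 j j.
pose a z : R := Xdot z ord0 j; pose b z : R := vt (Xt t z) ord0 j.
have mb : measurable_fun setT b.
  exact: (measurableT_comp (measurableT_comp (measurable_mx_coord ord0 j) mv) (measurable_Xt t)).
(* Square integrability of [b] comes from [b^2 = C_jj - Pi_jj], a difference of integrable
   functions. *)
have ibb : gamma.-integrable setT (EFin \o (fun z => b z * b z)).
  have := integrableB measurableT iC (integrable_PiX j j).
  apply: eq_integrable => // z _ /=.
  by rewrite -EFinB /Pi /outer !mxE opprB addrC subrK.
have iab : gamma.-integrable setT (EFin \o (fun z => a z * b z)).
  apply: (@integrable_le _ _ _ gamma _ (fun z => a z * a z + b z * b z)).
  - by apply: measurable_funM => //; exact: measurable_Xdot.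
  - exact: (integrableD measurableT iXX ibb).
  - move=> z; move: (a z) (b z) => x y; rewrite ler_norml.
    have := sqr_ge0 (x - y); have := sqr_ge0 (x + y).
    by move=> *; apply/andP; split; nra.
have Eab : (\int[gamma]_z (a z * b z)%:E = \int[gamma]_z (b z * b z)%:E)%E.
  apply: (cond_expectation_pull_out (measurable_Xt t) iX iv vA (g := fun x => vt x ord0 j)) => //.
  exact: (measurableT_comp (measurable_mx_coord ord0 j) mv).
have Eaa : (\int[gamma]_z (a z * a z)%:E = \int[gamma]_z (b z * b z)%:E)%E.
  have := CA setT measurableT.
  under eq_integral do rewrite indicT mulr1.
  under [X in _ = X -> _]eq_integral do rewrite indicT mulr1.
  move=> ->.
  transitivity (\int[gamma]_z ((Pi Ct vt (Xt t z) j j)%:E + (b z * b z)%:E))%E.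
    by apply: eq_integral => z _; rewrite -EFinD /Pi /outer !mxE subrK.
  by rewrite integralD//; [rewrite integral_Pi_diag add0e|exact: integrable_PiX].
have i2ab : gamma.-integrable setT (EFin \o (fun z => a z * b z + a z * b z)).
  exact: (integrableD measurableT iab iab).
have iaabb : gamma.-integrable setT (EFin \o (fun z => a z * a z + b z * b z)).
  exact: (integrableD measurableT iXX ibb).
have E0 : (\int[gamma]_z ((a z - b z) ^+ 2)%:E = 0)%E.
  transitivity (\int[gamma]_z ((a z * a z + b z * b z)%:E - (a z * b z + a z * b z)%:E))%E.
    by apply: eq_integral => z _; rewrite -EFinB; congr EFin; ring.
  rewrite integralB//.
  under eq_integral do rewrite EFinD.
  under [X in (_ - X)%E]eq_integral do rewrite EFinD.
  rewrite !integralD//= Eaa Eab subee// fin_numD.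
  by rewrite (integrable_fin_num _ ibb).
have m2 : measurable_fun setT (fun z => ((a z - b z) ^+ 2)%:E).
  apply/measurable_EFinP; apply: measurable_funX; apply: measurable_funB => //.
  exact: measurable_Xdot.
have : ae_eq gamma setT (fun z => ((a z - b z) ^+ 2)%:E) (cst 0%E).
  apply/(ae_eq_integral_abs _ measurableT m2).
  by under eq_integral do rewrite gee0_abs ?lee_fin ?sqr_ge0//.
apply: filterS => z /(_ I) [] /eqP; rewrite expf_eq0 /= subr_eq0 => /eqP.
by [].
Qed.

End Necessity.

Lemma measure_ae_eq {R : realType} disp (S : measurableType disp) (P : probability S R)
    (A B : set S) : measurable A -> measurable B ->
  {ae P, forall z, A z <-> B z} -> P A = P B.
Proof.
move=> mA mB AB.
have PE D : measurable D -> P D = (\int[P]_z (\1_D z)%:E)%E.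
  by move=> mD; rewrite integral_indic// setIT.
rewrite !PE//.
apply: ae_eq_integral => //.
- by apply/measurable_EFinP; exact: measurable_indic.
- by apply/measurable_EFinP; exact: measurable_indic.
apply: filterS AB => z AB _; rewrite !indicE; congr (_%:R)%:E.
by congr nat_of_bool; apply/idP/idP => /set_mem/AB/mem_set.
Qed.

Theorem theorem2p5 (R : realType) (d : nat)
  (P0 P1 : probability 'rV[R]_d R)
  (gamma : probability ('rV[R]_d * 'rV[R]_d)%type R)
  (rho : R -> 'rV[R]_d -> R) (v : R -> 'rV[R]_d -> 'rV[R]_d)
  (C : R -> 'rV[R]_d -> 'M[R]_d) :
  is_coupling P0 P1 gamma ->
  (forall t, 0 <= t <= 1 -> is_density gamma t (rho t)) ->
  (forall t, 0 <= t <= 1 -> is_cond_velocity gamma t (v t)) ->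
  (forall t, 0 <= t <= 1 -> is_cond_second_moment gamma t (C t)) ->
  jointly_C1 v ->
  flow_assumption v ->
  (forall t, 0 <= t <= 1 ->
     (\int[gamma]_z (sqnorm (Xt t z))%:E < +oo)%E) ->
  (forall t, 0 <= t <= 1 ->
     (\int[gamma]_z (sqnormM (Pi (C t) (v t) (Xt t z)))%:E < +oo)%E) ->
  (forall x, (fun t => Pi (C t) (v t) x) @ at_left 1 --> Pi (C 1) (v 1) x) ->
  [/\
    (* necessity *)
    ((forall t, 0 <= t <= 1 -> div_rhoPi_zero (rho t) (Pi (C t) (v t))) ->
     exists T : 'rV[R]_d -> 'rV[R]_d,
       [/\ measurable_fun setT T,
           (forall A : set 'rV[R]_d, measurable A -> pushforward P0 T A = P1 A) &
           (forall B : set ('rV[R]_d * 'rV[R]_d)%type, measurable B ->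
              pushforward P0 (fun x => (x, T x)) B = gamma B)]),
    (* sufficiency on [0,1) under a positive semi-definite Jacobian *)
    (forall T : 'rV[R]_d -> 'rV[R]_d,
       measurable_fun setT T ->
       (forall A : set 'rV[R]_d, measurable A -> pushforward P0 T A = P1 A) ->
       (forall B : set ('rV[R]_d * 'rV[R]_d)%type, measurable B ->
          pushforward P0 (fun x => (x, T x)) B = gamma B) ->
       (forall x, jacobian_psd T x) ->
       forall t, 0 <= t < 1 -> div_rhoPi_zero (rho t) (Pi (C t) (v t))) &
    (* in particular for a C^1 optimal transport map *)
    (forall T : 'rV[R]_d -> 'rV[R]_d,
       is_OT_map P0 P1 T -> C1map T ->
       (forall B : set ('rV[R]_d * 'rV[R]_d)%type, measurable B ->
          pushforward P0 (fun x => (x, T x)) B = gamma B) ->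
       forall t, 0 <= t < 1 -> div_rhoPi_zero (rho t) (Pi (C t) (v t)))].
Proof.
move=> [gP0 gP1] rhoP vP CP _ _ fin2 finPi _.
have h01 (t : R) : 0 <= t < 1 -> 0 <= t <= 1 by move=> /andP[-> /ltW].
split.
- move=> div0; have t0 : 0 <= (0 : R) <= 1 by apply/andP; split; [exact: lexx|exact: ler01].
  (* At time 0 the position is [X_0], and [X_1] is [X_0] plus the velocity. *)
  pose T x := x + v 0 x.
  have [mv _] := vP 0 t0.
  have mT : measurable_fun setT T.
    apply: measurable_fun_rV => i; rewrite /T; under eq_fun do rewrite mxE.
    apply: measurable_funD; first exact: measurable_mx_coord.
    exact: (measurableT_comp (measurable_mx_coord ord0 i) mv).
  have mG : measurable_fun setT (fun x => (x, T x)) by exact: measurable_fun_pair.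
  have zT : {ae gamma, forall z, z.2 = T z.1}.
    have : {ae gamma, forall z, forall j : 'I_d, Xdot z ord0 j = v 0 (Xt 0 z) ord0 j}.
      apply: filter_forall => j.
      exact: (ae_Xdot_velocity (rhoP 0 t0) (vP 0 t0) (CP 0 t0) fin2
        (finPi 0 t0) (div0 0 t0)).
    apply: filterS => z zv; apply/rowP => j; have := zv j.
    rewrite /Xt subr0 scale1r scale0r addr0 /T /Xdot !mxE => <-.
    by rewrite addrC subrK.
  (* Almost surely the pair lies on the graph of [T], so membership in [B] can be read on the first
     coordinate, whose law is [P0]. *)
  have TG B : measurable B -> pushforward P0 (fun x => (x, T x)) B = gamma B.
    move=> mB.
    have mA : measurable ((fun x => (x, T x)) @^-1` B)
      by rewrite -[X in measurable X]setTI; exact: mG.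
    rewrite /pushforward -gP0//; apply: measure_ae_eq => //.
      rewrite -[X in measurable X]setTI; exact: measurable_fst.
    by apply: filterS zT => -[x y] /= ->.
  exists T; split=> // A mA; rewrite -gP1//.
  have mA2 : measurable (snd @^-1` A : set ('rV[R]_d * 'rV[R]_d)).
    rewrite -[X in measurable X]setTI; exact: measurable_snd.
  exact: (TG _ mA2).
- move=> T mT _ gT psd t t01.
  have cT : continuous T by move=> x; apply: differentiable_continuous; case: (psd x).
  (* Monotonicity holds everywhere, so [K] is the whole space. *)
  apply: (div_rhoPi_zero_monotone_map t01 (rhoP t (h01 t t01)) (vP t (h01 t t01))
    (CP t (h01 t t01)) fin2 cT closedT _ _ gT).
    by rewrite setCT measure0.
  by move=> x y _ _; exact: jacobian_psd_monotone.
- move=> T OT [dT _] gT t t01.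
  have cT : continuous T by move=> x; exact: differentiable_continuous.
  have mT := continuous_measurable_rV cT.
  have mG : measurable_fun setT (fun x => (x, T x)) by exact: measurable_fun_pair.
  (* The transport cost of [T] is the expected squared velocity under [gamma], finite by the second
     moments of the endpoints. *)
  have fincost : (\int[P0]_x (sqnorm (x - T x))%:E < +oo)%E.
    pose f (z : 'rV[R]_d * 'rV[R]_d) := (\sum_(i < d) Xdot z ord0 i * Xdot z ord0 i)%:E.
    have mf : measurable_fun setT f.
      apply/measurable_EFinP; apply: measurable_sum => i.
      by apply: measurable_funM; exact: measurable_Xdot.
    have f0 z : (0 <= f z)%E.
      by rewrite lee_fin; apply: sumr_ge0 => i _; rewrite -expr2 sqr_ge0.
    have if_ : gamma.-integrable setT f.
      have -> : f = (fun z => \sum_(i < d) (Xdot z ord0 i * Xdot z ord0 i)%:E)%E.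
        by apply/funext => z; rewrite /f -sumEFin.
      by apply: integrable_sum => // i _; exact: integrable_XdotM.
    have := integrable_lty measurableT if_.
    suff -> : (\int[gamma]_z f z = \int[P0]_x (sqnorm (x - T x))%:E)%E by apply.
    pose mixG := isMeasurableFun.Build _ _ _ _ _ mG.
    pose packG : {mfun 'rV[R]_d >-> ('rV[R]_d * 'rV[R]_d)%type} :=
      HB.pack (fun x => (x, T x)) mixG.
    rewrite (eq_measure_integral (distribution P0 packG)); last first.
      by move=> A mA _; exact/esym/gT.
    rewrite ge0_integral_distribution//; apply: eq_integral => x _.
    rewrite /= /f /Xdot /sqnorm /dotv; congr EFin; apply: eq_bigr => i _.
    by rewrite !mxE; ring.
  (* Here [K] is the support of [P0], on which optimality gives monotonicity. *)
  have mono := pairwise_monotone_support cT (OT_map_pairwise_monotone OT fincost).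
  apply: (div_rhoPi_zero_monotone_map t01 (rhoP t (h01 t t01)) (vP t (h01 t t01))
    (CP t (h01 t t01)) fin2 cT (@closed_support _ _ P0) (support_full P0) mono gT).
Qed.
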